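(* Let $G$ be a countable infinite discrete group acting by homeomorphisms on a compact Hausdorff space $X$. The following are equivalent: (1) For every pair of closed ideals $I$ and $J$ of $\ell^1(G\curvearrowright X)$, if $I\cap C(X)=J\cap C(X)$ then $I=J$. (2) $E(I)\subset I$ for every closed ideal $I$ of $\ell^1(G\curvearrowright X)$. (3) The action $G\curvearrowright X$ is residually topologically free.
   Context: Write $\sigma_s:X\to X$ for the homeomorphism given by $s\in G$, $e$ for the identity of $G$, and $C(X)$ for the continuous functions $X\to\mathbb{C}$ with the supremum norm $\|\cdot\|_\infty$. Set $\alpha_s(f)(x)=f(\sigma_s^{-1}(x))$ for $s\in G$, $f\in C(X)$, $x\in X$. $\ell^1(G\curvearrowright X)$ is the Banach $*$-algebra of all functions $f:G\to C(X)$ with $\|f\|=\sum_{s\in G}\|f(s)\|_\infty<\infty$, with pointwise linear operations, product $(fg)(s)=\sum_{t\in G}f(t)\,\alpha_t(g(t^{-1}s))$ and involution $(f^* )(s)=\alpha_s(\overline{f(s^{-1})})$. $C(X)$ is identified with the subalgebra of those $f\in\ell^1(G\curvearrowright X)$ supported on $\{e\}$. The canonical projection $E:\ell^1(G\curvearrowright X)\to C(X)$ is $E(f)=f(e)$. ''Ideal'' means two-sided ideal. An action of $G$ on a space $Y$ by homeomorphisms is topologically free if the set of points of $Y$ not fixed by any $s\in G\setminus\{e\}$ is dense in $Y$. The action $G\curvearrowright X$ is residually topologically free if for every closed $G$-invariant subset $D$ of $X$ the restricted action $G\curvearrowright D$ is topologically free. *)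

(* Defs.v *)
From HB Require Import structures.
From mathcomp Require Import all_boot all_order all_algebra.
From mathcomp Require Import all_classical all_reals all_analysis.
From mathcomp Require Import complex.
From mathcomp Require Import finmap.
From mathcomp.analysis.showcase Require summability.

Set Implicit Arguments.
Unset Strict Implicit.
Unset Printing Implicit Defensive.

Import Order.TTheory GRing.Theory Num.Theory.
Import numFieldNormedType.Exports.

Local Open Scope classical_set_scope.
Local Open Scope ring_scope.
Local Open Scope complex_scope.

(* [R[i]] itself carries no topology; its regular module [R[i]^o] does, the one
   given by the modulus. *)
Notation Cplx R := (R[i]^o) (only parsing).

Section Actions.
Context (G : groupType).

Record homeo_action (Y : topologicalType) (sigma : G -> Y -> Y) : Prop :=
  HomeoAction {
    homeo_action1 : forall y, sigma 1%g y = y;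
    homeo_actionM : forall s t y, sigma (s * t)%g y = sigma s (sigma t y);
    homeo_action_continuous : forall s, continuous (sigma s)
  }.

Definition topologically_free (Y : topologicalType) (sigma : G -> Y -> Y) :=
  dense [set y | forall s, s != 1%g -> sigma s y <> y].

Context (X : topologicalType) (sigma : G -> X -> X).

Definition invariant_set (D : set X) := forall s x, D x -> D (sigma s x).

(* The action on the subtype of [D], which has the subspace topology. *)
Definition restricted_action (D : set X) (invD : invariant_set D)
    (s : G) (y : D) : D :=
  exist _ (sigma s (set_val y)) (mem_set (invD s _ (set_valP y))).

Definition residually_topologically_free :=
  forall (D : set X) (invD : invariant_set D),
    closed D -> topologically_free (restricted_action invD).

End Actions.

Section CrossedProduct.
Context (R : realType) (G : groupType) (X : topologicalType).

(* The modulus on [R[i]] takes values in [R[i]], whence [complex.Re]. If [X] is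
   empty this is [sup set0 = 0]. *)
Definition supnorm (h : X -> Cplx R) : R :=
  sup [set complex.Re `|h x| | x in [set: X]].

Definition ell1_norm (f : G -> X -> Cplx R) : \bar R :=
  \esum_(s in [set: G]) (supnorm (f s))%:E.

Definition ell1 : set (G -> X -> Cplx R) :=
  [set f | (forall s, continuous (f s)) /\ (ell1_norm f < +oo)%E].

Definition CX : set (G -> X -> Cplx R) :=
  [set f | ell1 f /\ forall s, s != 1%g -> f s = 0].

Definition CX_incl (h : X -> Cplx R) : G -> X -> Cplx R :=
  fun s => if s == 1%g then h else 0.

Definition cond_proj (f : G -> X -> Cplx R) : X -> Cplx R := f 1%g.

Context (sigma : G -> X -> X).

(* For a [homeo_action], [sigma s^-1] is the inverse of [sigma s]. *)
Definition alpha (s : G) (h : X -> Cplx R) : X -> Cplx R :=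
  fun x => h (sigma s^-1%g x).

(* The sum over [G] is unordered: the limit of the finite partial sums for the
   supremum norm, that is for uniform convergence on [X]. It exists whenever
   [f] and [g] are in [ell1], and [get] is a default value otherwise. *)
Definition ell1_mul (f g : G -> X -> Cplx R) : G -> X -> Cplx R :=
  fun s =>
    let partial (A : {fset G}) : X -> Cplx R :=
      \sum_(t <- A) f t * alpha t (g (t^-1 * s)%g) in
    get (fun h : X -> Cplx R =>
      {uniform, partial @ summability.totally --> h}).

Record closed_ideal (I : set (G -> X -> Cplx R)) : Prop := ClosedIdeal {
  closed_ideal_sub : I `<=` ell1;
  closed_ideal0 : I 0;
  closed_idealD : forall f g, I f -> I g -> I (f + g);
  closed_idealZ : forall (a : R[i]) f, I f -> I (a *: f);
  closed_idealMl : forall f g, ell1 f -> I g -> I (ell1_mul f g);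
  closed_idealMr : forall f g, I f -> ell1 g -> I (ell1_mul f g);
  closed_ideal_closed : forall f, ell1 f ->
    (forall e : R, 0 < e -> exists2 g, I g & (ell1_norm (f - g)%R < e%:E)%E) ->
    I f
}.

End CrossedProduct.

Arguments CX {R G X}.
Arguments ell1 {R G X}.

(* Main.v *)
Require Import Defs.
From HB Require Import structures.
From mathcomp Require Import all_boot all_order all_algebra.
From mathcomp Require Import all_classical all_reals all_analysis.
From mathcomp Require Import complex.
From mathcomp Require Import finmap.
From mathcomp Require Import ring lra.
From mathcomp.analysis.showcase Require summability.

(** For a closed ideal [I] let [D] be the common zero set (the hull) of
    [I `&` CX].  It is closed and invariant, and every continuous function
    vanishing on [D] lies in [I]; hence [I] contains the closed ideal of all [f]
    whose coefficients vanish on [D], and both meet [CX] in the same set.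

    If [x] has trivial stabiliser and [f] in [I] has [f 1 x <> 0], then cutting
    [f] down to [p f q / f 1 x], with [p] concentrated near [x] and [q] vanishing
    at the finitely many relevant translates of [x], gives an element of [I] at
    distance at most [1/2] from [p].  For [k] with [p k = k], iterating
    [k = p k] shows that [k] is a limit of elements of [I], so [x] is not in [D].
    By residual topological freeness [f 1] therefore vanishes on [D], and so do
    the other coefficients of [f].

    If the action on some closed invariant [D] is not topologically free, the Baire
    category theorem gives [s <> 1] fixing a relatively open part of [D]
    pointwise.  With [h] a bump function there, [h - h delta_s] acts as zero in
    the permutation representations on the orbits in [D], while [h] does not. *)

Set Implicit Arguments.
Unset Strict Implicit.
Unset Printing Implicit Defensive.

Import Order.TTheory GRing.Theory Num.Theory.
Import numFieldNormedType.Exports.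

Local Open Scope classical_set_scope.
Local Open Scope ring_scope.
Local Open Scope complex_scope.

(** * The modulus as a real number, and continuity expressed through it *)

Section ComplexModulus.
Context (R : realType).
Implicit Types z w : Cplx R.

Definition cmod z : R := complex.Re `|z|.

Lemma normE z : `|z| = (cmod z)%:C.
Proof. by rewrite /cmod [Num.norm z]normc_def. Qed.

Lemma cmod_ge0 z : 0 <= cmod z.
Proof. by rewrite -ler0c -normE. Qed.

Lemma cmod0 : cmod 0 = 0.
Proof. by rewrite /cmod normr0. Qed.

Lemma cmod_eq0 z : cmod z = 0 -> z = 0.
Proof. by move=> h; apply: normr0_eq0; rewrite normE h. Qed.

Lemma cmod1 : cmod 1 = 1.
Proof. by rewrite /cmod normr1. Qed.

Lemma cmodM z w : cmod (z * w) = cmod z * cmod w.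
Proof.
by apply: (@complexI R); rewrite rmorphM /= -!normE normrM.
Qed.

Lemma cmodV z : cmod z^-1 = (cmod z)^-1.
Proof. by apply: (@complexI R); rewrite fmorphV /= -!normE normfV. Qed.

Lemma cmodD z w : cmod (z + w) <= cmod z + cmod w.
Proof. by rewrite -lecR rmorphD /= -!normE; exact: ler_normD. Qed.

Lemma cmodN z : cmod (- z) = cmod z.
Proof. by rewrite /cmod normrN. Qed.

Lemma cmodBC z w : cmod (z - w) = cmod (w - z).
Proof. by rewrite -cmodN opprB. Qed.

Lemma cmodB z w : cmod (z - w) <= cmod z + cmod w.
Proof. by rewrite -(cmodN w); exact: cmodD. Qed.

Lemma cmodR (r : R) : cmod (r%:C) = `|r|.
Proof. by rewrite /cmod [Num.norm _]normc_def /= expr0n /= addr0 sqrtr_sqr. Qed.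

Lemma cmod_sum (I : Type) (s : seq I) (F : I -> Cplx R) :
  cmod (\sum_(i <- s) F i) <= \sum_(i <- s) cmod (F i).
Proof.
elim/big_rec2 : _ => [|i r z _ h]; first by rewrite cmod0.
by apply: le_trans (cmodD _ _) _; rewrite lerD2l.
Qed.

Lemma cmod_Re z : `|complex.Re z| <= cmod z.
Proof. by rewrite -lecR -normE; exact: normc_ge_Re. Qed.

Lemma cmod_Im z : `|complex.Im z| <= cmod z.
Proof.
rewrite /cmod [Num.norm z]normc_def /= -sqrtr_sqr ler_wsqrtr//.
by rewrite lerDr sqr_ge0.
Qed.

Lemma cmod_le_ReIm z : cmod z <= `|complex.Re z| + `|complex.Im z|.
Proof.
have zE : z = (complex.Re z)%:C + 'i%C * (complex.Im z)%:C :> R[i].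
  by case: z => a b; simpc.
rewrite {1}zE; apply: le_trans (cmodD _ _) _.
rewrite cmodM !cmodR; suff -> : cmod 'i%C = 1 by rewrite mul1r.
by rewrite /cmod [Num.norm _]normc_def /= expr0n /= add0r expr1n sqrtr1.
Qed.

Lemma contP (T : topologicalType) (h : T -> Cplx R) (x : T) :
  {for x, continuous h} <->
  (forall e : R, 0 < e -> \forall y \near x, cmod (h x - h y) < e).
Proof.
split=> [/cvgrPdist_lt hx e e0|hx].
  have := hx e%:C; rewrite (ltcR 0) => /(_ e0).
  by apply: filterS => y; rewrite normE ltcR.
apply/cvgrPdist_lt => e e0.
(* A positive element of [R[i]] has zero imaginary part, so real bounds suffice. *)
have eE : e = (complex.Re e)%:C 
  by move: e0; rewrite ltcE; case: e => a b /= /andP[/eqP-> _].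
have re0 : 0 < complex.Re e by rewrite -ltcR -eE.
by rewrite eE; apply: filterS (hx _ re0) => y; rewrite normE ltcR.
Qed.

Lemma continuous_cmod (T : topologicalType) (h : T -> Cplx R) :
  continuous h -> continuous (cmod \o h).
Proof.
move=> ch x; apply/cvgrPdist_lt => e e0.
have /contP/(_ e e0) := ch x; apply: filterS => y.
apply: le_lt_trans; rewrite ler_norml; apply/andP; split.
  rewrite lerNl opprB lerBlDr cmodBC.
  by apply: le_trans (cmodD _ _); rewrite subrK.
by rewrite lerBlDr; apply: le_trans (cmodD _ _); rewrite subrK.
Qed.

Lemma continuous_ofR (T : topologicalType) (r : T -> R) :
  continuous r -> continuous (fun x => (r x)%:C : Cplx R).
Proof.
move=> cr x; apply/contP => e e0.
have /cvgrPdist_lt/(_ e e0) := cr x; apply: filterS => y.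
by rewrite -rmorphB cmodR.
Qed.

Lemma continuous_conj (T : topologicalType) (h : T -> Cplx R) :
  continuous h -> continuous (fun x => (h x)^*%C : Cplx R).
Proof.
move=> ch x; apply/contP => e e0.
have /contP/(_ e e0) := ch x; apply: filterS => y.
congr (_ < _); rewrite -raddfB /=.
rewrite /cmod [in LHS]normc_def [in RHS]normc_def /=.
by case: (h x - h y) => a b /=; rewrite sqrrN.
Qed.

Lemma mul_conjE z : z * z^*%C = (cmod z ^+ 2)%:C.
Proof. by rewrite -sqr_normc normE rmorphXn. Qed.

End ComplexModulus.

Lemma fsum_setD (V : nmodType) (I : choiceType) (A B : {fset I}) (F : I -> V) :
  (A `<=` B)%fset ->
  \sum_(i <- B) F i = \sum_(i <- A) F i + \sum_(i <- (B `\` A)%fset) F i.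
Proof.
move=> /fsubsetP AB; rewrite (big_fsetID _ (mem A)) /=; congr (_ + _).
  congr (\sum_(i <- enum_fset _) _); apply/fsetP => i; rewrite !inE /=.
  by have [/AB->|] := boolP (i \in A); rewrite ?andbF.
by congr (\sum_(i <- enum_fset _) _); apply/fsetP => i; rewrite !inE /= andbC.
Qed.

(** * The supremum norm on a compact space *)

Section SupNorm.
Context (R : realType) (X : topologicalType).
Hypothesis Xc : compact [set: X].
Implicit Types h k : X -> Cplx R.

Lemma supnorm_ge0 h : 0 <= supnorm h.
Proof.
rewrite /supnorm; set S := (X in sup X).
(* If [X] is empty or [h] is unbounded, [sup] takes its default value 0. *)
have [ss|/sup_out->//] := pselect (has_sup S).
have [[y [x _ xy]] _] := ss; apply: (@le_trans _ _ (cmod (h x))); first exact: cmod_ge0.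
by apply: sup_upper_bound => //; exists x.
Qed.

Lemma supnorm_le h (M : R) :
  0 <= M -> (forall x, cmod (h x) <= M) -> supnorm h <= M.
Proof.
move=> M0 hM; rewrite /supnorm; set S := (X in sup X).
have [->|/set0P ne] := eqVneq S set0.
  by rewrite sup0.
by apply: ge_sup => // _ [x _ <-]; exact: hM.
Qed.

Lemma le_supnorm h x : continuous h -> cmod (h x) <= supnorm h.
Proof.
move=> ch; apply: sup_upper_bound; last by exists x.
split; first by exists (cmod (h x)), x.
have : compact [set (@cmod R \o h) y | y in [set: X]].
  apply: continuous_compact => //.
  by apply: continuous_subspaceT; exact: continuous_cmod.
move=> /compact_bounded[M [_ /(_ (M + 1))]]; rewrite ltrDl ltr01 => /(_ isT) hM.
exists (M + 1) => _ [y _ <-].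
by apply: le_trans (hM (cmod (h y)) _); [exact: ler_norm|exists y].
Qed.

Lemma supnormD h k : continuous h -> continuous k ->
  supnorm (h + k) <= supnorm h + supnorm k.
Proof.
move=> ch ck; apply: supnorm_le => [|x]; first by rewrite addr_ge0// supnorm_ge0.
by apply: le_trans (cmodD _ _) _; rewrite lerD// le_supnorm.
Qed.

Lemma supnorm0 : supnorm (0 : X -> Cplx R) = 0.
Proof.
apply/eqP; rewrite eq_le supnorm_ge0 andbT supnorm_le// => x.
by rewrite cmod0.
Qed.

End SupNorm.

(** * The norm of [ell1] through finite partial sums *)

Section Ell1.
Context (R : realType) (G : groupType) (X : topologicalType).
Implicit Types f g : G -> X -> Cplx R.

(** The norm as a real number, meaningful on [ell1]; where [ell1_norm] is infinite, [fine] returns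
    0. *)
Definition n1 f : R := fine (ell1_norm f).

Lemma ell1_norm_leP f (M : R) :
  (forall A : {fset G}, \sum_(s <- A) supnorm (f s) <= M) <->
  (ell1_norm f <= M%:E)%E.
Proof.
split=> [fM|fM A].
  apply: ge_ereal_sup => _ [A [finA _] <-].
  by rewrite fsbig_finite// sumEFin lee_fin.
rewrite -lee_fin -sumEFin; apply: le_trans fM.
apply: esum_ge; exists [set` A]; first by split.
by rewrite fsbig_finite// set_fsetK.
Qed.

Lemma ell1_norm_ge0 f : (0 <= ell1_norm f)%E.
Proof. by apply: esum_ge0 => s _; rewrite lee_fin supnorm_ge0. Qed.

Lemma ell1_normE f : ell1 f -> ell1_norm f = (n1 f)%:E.
Proof.
by move=> [_ foo]; rewrite fineK// ge0_fin_numE// ell1_norm_ge0.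
Qed.

Lemma ell1_continuous f s : ell1 f -> continuous (f s).
Proof. by case. Qed.

Lemma n1_ge0 f : 0 <= n1 f.
Proof. by rewrite fine_ge0// ell1_norm_ge0. Qed.

Lemma sum_le_n1 f (A : {fset G}) : ell1 f -> \sum_(s <- A) supnorm (f s) <= n1 f.
Proof. by move=> lf; move: A; apply/ell1_norm_leP; rewrite -ell1_normE. Qed.

Lemma supnorm_le_n1 f s : ell1 f -> supnorm (f s) <= n1 f.
Proof.
by move=> lf; apply: le_trans (sum_le_n1 [fset s]%fset lf); rewrite big_seq_fset1.
Qed.

Lemma n1_le f (M : R) : (forall s, continuous (f s)) ->
  (forall A : {fset G}, \sum_(s <- A) supnorm (f s) <= M) ->
  ell1 f /\ n1 f <= M.
Proof.
move=> cf /ell1_norm_leP fM.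
have lf : ell1 f by split=> //; apply: le_lt_trans fM _; rewrite ltry.
by split=> //; rewrite -lee_fin -ell1_normE.
Qed.

(** Otherwise every finite partial sum could be enlarged by more than [e], and [n1 f - e] would
    bound them all. *)
Lemma ell1_tail f (e : R) : ell1 f -> 0 < e ->
  exists A0 : {fset G}, forall A : {fset G},
    \sum_(s <- (A `\` A0)%fset) supnorm (f s) <= e.
Proof.
move=> lf e0; apply: contrapT => /forallNP hA.
have : (ell1_norm f <= (n1 f - e)%:E)%E.
  apply/ell1_norm_leP => A0.
  have /existsNP[A /negP] := hA A0.
  rewrite -ltNge => eA; rewrite lerBrDr; apply: le_trans (sum_le_n1 (A0 `|` A)%fset lf).
  rewrite (fsum_setD _ (fsubsetUl A0 A)) fsetDUl fsetDv fset0U.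
  by rewrite lerD2l ltW.
by rewrite ell1_normE// lee_fin lerBrDr gerDl leNgt e0.
Qed.

End Ell1.

#[local] Existing Instance summability.totally_filter.

(** * Unordered sums, first of scalars, then uniformly on [X] *)

Section UniformSums.
Context (R : realType) (G : choiceType).

(** The finite partial sums form a Cauchy net. The error is bounded by tails of the majorant [a]
    alone, hence uniformly for all families that share this majorant. *)
Lemma real_unordered_sum (r a : G -> R) :
  (forall t, `|r t| <= a t) ->
  (forall e : R, 0 < e -> exists A0 : {fset G}, forall A : {fset G},
     \sum_(t <- (A `\` A0)%fset) a t <= e) ->
  exists l : R, forall (A0 : {fset G}) (e : R),
    (forall A : {fset G}, \sum_(t <- (A `\` A0)%fset) a t <= e) ->
    `|l - \sum_(t <- A0) r t| <= e.
Proof.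
move=> ra tail; pose P (A : {fset G}) := \sum_(t <- A) r t.
have close (A0 A : {fset G}) (e : R) : (A0 `<=` A)%fset ->
    (forall B : {fset G}, \sum_(t <- (B `\` A0)%fset) a t <= e) ->
    `|P A - P A0| <= e.
  move=> A0A hA0; rewrite /P (fsum_setD _ A0A) addrAC subrr add0r.
  apply: le_trans (hA0 A); apply: le_trans (ler_norm_sum _ _ _) _.
  by rewrite ler_sum.
have cP : cvg (P @ summability.totally).
  apply: cauchy_cvg; apply: cauchy_exP => e /= e0.
  have [|A0 hA0] := tail (e / 2); first by rewrite divr_gt0.
  exists (P A0), A0 => // A /= A0A.
  rewrite -ball_normE /= distrC.
  by apply: le_lt_trans (close _ _ _ A0A hA0) _; rewrite gtr_pMr// invf_lt1// ltr1n.
exists (lim (P @ summability.totally)) => A0 e hA0.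
apply/ler_addgt0Pr => d d0.
move/cvgrPdist_lt : cP => /(_ d d0) [B _ hB].
have := hB (A0 `|` B)%fset (fsubsetUr _ _) => /= h1.
have h2 := close _ _ _ (fsubsetUl A0 B) hA0.
rewrite -(subrK (P (A0 `|` B)%fset) (lim _)) -addrA addrC.
by apply: le_trans (ler_normD _ _) _; rewrite lerD// ltW.
Qed.

(** Real and imaginary parts are summed separately, and each contributes an error [e]. *)
Lemma complex_unordered_sum (F : G -> Cplx R) (a : G -> R) :
  (forall t, cmod (F t) <= a t) ->
  (forall e : R, 0 < e -> exists A0 : {fset G}, forall A : {fset G},
     \sum_(t <- (A `\` A0)%fset) a t <= e) ->
  exists l : Cplx R, forall (A0 : {fset G}) (e : R),
    (forall A : {fset G}, \sum_(t <- (A `\` A0)%fset) a t <= e) ->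
    cmod (l - \sum_(t <- A0) F t) <= e + e.
Proof.
move=> Fa tail.
have [|u hu] := @real_unordered_sum (fun t => complex.Re (F t)) a _ tail.
  by move=> t; apply: le_trans (cmod_Re _) _.
have [|v hv] := @real_unordered_sum (fun t => complex.Im (F t)) a _ tail.
  by move=> t; apply: le_trans (cmod_Im _) _.
exists (u +i* v) => A0 e hA0; apply: le_trans (cmod_le_ReIm _) _.
rewrite !raddfB /= [complex.Re (bigop.body _ _ _)]raddf_sum.
rewrite [complex.Im (bigop.body _ _ _)]raddf_sum.
by rewrite lerD//; [exact: hu|exact: hv].
Qed.

Context (X : topologicalType).
Implicit Types (F : G -> X -> Cplx R) (h k : X -> Cplx R).

(** Uniform convergence of the net of finite partial sums, spelled out with real bounds;
    [uniform_cvgP] links this form to the filter used in [ell1_mul]. *)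
Definition usums F h := forall e : R, 0 < e -> exists A0 : {fset G},
  forall A, (A0 `<=` A)%fset -> forall x, cmod (h x - \sum_(t <- A) F t x) < e.

Lemma usums_unique F h k : usums F h -> usums F k -> h = k.
Proof.
move=> Fh Fk; apply/funext => x; apply/eqP; rewrite -subr_eq0; apply/eqP.
apply: cmod_eq0; apply/eqP; rewrite eq_le cmod_ge0 andbT; apply/ler_addgt0Pr => e e0.
have [|A hA] := Fh (e / 2); first by rewrite divr_gt0.
have [|B hB] := Fk (e / 2); first by rewrite divr_gt0.
have h1 := hA _ (fsubsetUl A B) x; have h2 := hB _ (fsubsetUr A B) x.
rewrite add0r (splitr e) -(subrK (\sum_(t <- (A `|` B)%fset) F t x) (h x)) -addrA.
apply: le_trans (cmodD _ _) _; rewrite lerD// ltW//.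
by rewrite cmodBC.
Qed.

Lemma usumsB F F' h k : usums F h -> usums F' k ->
  usums (fun t => F t - F' t) (h - k).
Proof.
move=> Fh Fk e e0.
have [|A hA] := Fh (e / 2); first by rewrite divr_gt0.
have [|B hB] := Fk (e / 2); first by rewrite divr_gt0.
exists (A `|` B)%fset => C; rewrite fsubUset => /andP[AC BC] x.
have h1 := hA _ AC x; have h2 := hB _ BC x.
rewrite (splitr e).
have -> : (h - k) x - \sum_(t <- C) (F t - F' t) x =
  (h x - \sum_(t <- C) F t x) - (k x - \sum_(t <- C) F' t x).
  have -> : \sum_(t <- C) (F t - F' t) x =
    \sum_(t <- C) F t x - \sum_(t <- C) F' t x by rewrite -sumrB.
  by rewrite [(h - k) x]/(h x - k x) !opprD !opprK addrACA.
by apply: le_lt_trans (cmodB _ _) _; rewrite ltrD.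
Qed.

Lemma usums_eventually F h (A0 : {fset G}) :
  (forall A x, (A0 `<=` A)%fset -> \sum_(t <- A) F t x = h x) -> usums F h.
Proof. by move=> hF e e0; exists A0 => A /hF hA x; rewrite hA subrr cmod0. Qed.

Lemma uniform_cvgP (P : {fset G} -> X -> Cplx R) h :
  {uniform, P @ summability.totally --> h} <->
  forall e : R, 0 < e -> exists A0 : {fset G},
    forall A, (A0 `<=` A)%fset -> forall x, cmod (h x - P A x) < e.
Proof.
split=> [hP e e0|hP].
- have := hP [set k | forall x, ball (h x) e%:C (k x)].
  case.
    apply/uniform_nbhs; exists [set xy | ball xy.1 e%:C xy.2]; split.
      by rewrite -entourage_ballE; exists e%:C => //=; rewrite (ltcR 0).
    by move=> k /= hk x; exact: hk.
  move=> A0 _ hA0; exists A0 => A /hA0 /= + x => /(_ x).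
  by rewrite -ball_normE /= normE ltcR.
- move=> Q /uniform_nbhs[E [+ EQ]].
  rewrite -entourage_ballE => -[e /= e0 eE].
  have eR : e = (complex.Re e)%:C.
    by move: e0; rewrite ltcE; case: e {eE} => a b /= /andP[/eqP-> _].
  have [|A0 hA0] := hP (complex.Re e); first by rewrite -ltcR -eR.
  exists A0 => // A /hA0 hA; apply: EQ => x _; apply: eE => /=.
  by rewrite -ball_normE /= normE eR ltcR.
Qed.

Lemma usums_continuous F h :
  (forall t, continuous (F t)) -> usums F h -> continuous h.
Proof.
move=> cF Fh x; apply/contP => e e0.
have [|A /(_ A (fsubset_refl _)) hA] := Fh (e / 3); first by rewrite divr_gt0.
have cS : continuous (fun y => \sum_(t <- A) F t y).
  elim: (enum_fset A) => [|t s IH] y.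
    by under eq_fun do rewrite big_nil; exact: cst_continuous.
  by under eq_fun do rewrite big_cons; apply: continuousD; [exact: cF|exact: IH].
have /contP/(_ (e / 3)) := cS x; rewrite divr_gt0// => /(_ isT).
apply: filterS => y /= h3.
have h1 := hA x; have h2 := hA y.
have -> : h x - h y = (h x - \sum_(t <- A) F t x)
  + (\sum_(t <- A) F t x - \sum_(t <- A) F t y) - (h y - \sum_(t <- A) F t y) by ring.
apply: le_lt_trans (cmodB _ _) _.
have := cmodD (h x - \sum_(t <- A) F t x)
  (\sum_(t <- A) F t x - \sum_(t <- A) F t y).
by lra.
Qed.

End UniformSums.

(** * The convolution product: existence, continuity and submultiplicativity of the norm *)

Section Product.
Context (R : realType) (G : groupType) (X : topologicalType).
Context (sigma : G -> X -> X).
Hypothesis Xc : compact [set: X].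
Hypothesis sa : homeo_action sigma.
Implicit Types (f g : G -> X -> Cplx R) (h k : X -> Cplx R).

Lemma sigmaK s : cancel (sigma s) (sigma s^-1%g).
Proof. by move=> x; rewrite -(homeo_actionM sa) mulVg (homeo_action1 sa). Qed.

Lemma sigmaVK s : cancel (sigma s^-1%g) (sigma s).
Proof. by move=> x; rewrite -(homeo_actionM sa) mulgV (homeo_action1 sa). Qed.

Lemma continuous_translate s h : continuous h -> continuous (h \o sigma s).
Proof.
move=> ch x; apply: continuous_comp; [exact: (homeo_action_continuous sa)|exact: ch].
Qed.

Definition mul_term f g (s t : G) : X -> Cplx R :=
  fun x => f t x * g (t^-1 * s)%g (sigma t^-1%g x).

Lemma continuous_mul_term f g s t : (forall u, continuous (f u)) ->
  (forall u, continuous (g u)) -> continuous (mul_term f g s t).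
Proof.
move=> cf cg x; apply: (@continuousM _ _ (f t) (g _ \o _)); first exact: cf.
exact: continuous_translate.
Qed.

(** As soon as some uniform limit exists, [get] returns one, and uniform limits are unique. *)
Lemma ell1_mul_unique f g s h :
  usums (mul_term f g s) h -> ell1_mul sigma f g s = h.
Proof.
have partialE (A : {fset G}) x : (\sum_(t <- A) f t * alpha sigma t (g (t^-1 * s)%g)) x =
    \sum_(t <- A) mul_term f g s t x.
  by rewrite fct_sumE.
move=> fgh; rewrite /ell1_mul; set L := (X in get X).
have Lh : L h.
  apply/uniform_cvgP => e /fgh [A0 hA0]; exists A0 => A /hA0 hA x.
  by rewrite partialE.
have /uniform_cvgP Lget : L (get L) by exact: getI Lh.
apply: (@usums_unique _ _ _ (mul_term f g s)) fgh => e /Lget[A0 hA0].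
by exists A0 => A /hA0 hA x; rewrite -partialE.
Qed.

Lemma le_mul_term f g s t x : ell1 f -> ell1 g ->
  cmod (mul_term f g s t x) <= supnorm (f t) * supnorm (g (t^-1 * s)%g).
Proof.
move=> lf lg; rewrite cmodM ler_pM ?cmod_ge0 ?le_supnorm//.
  exact: ell1_continuous lf.
exact: ell1_continuous lg.
Qed.

(** The terms are dominated by [supnorm (f t) * n1 g], which involves neither [x] nor [s]; the error
    is therefore uniform in both. *)
Lemma ell1_mul_approx f g s (A0 : {fset G}) (e : R) : ell1 f -> ell1 g ->
  (forall A : {fset G}, \sum_(t <- (A `\` A0)%fset) supnorm (f t) <= e) ->
  forall x, cmod (ell1_mul sigma f g s x - \sum_(t <- A0) mul_term f g s t x)
    <= (e + e) * n1 g.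
Proof.
move=> lf lg hA0.
pose a t := supnorm (f t) * n1 g.
have aE (A : {fset G}) : \sum_(t <- A) a t = (\sum_(t <- A) supnorm (f t)) * n1 g.
  by rewrite mulr_suml.
have tail (e' : R) : 0 < e' -> exists A1 : {fset G}, forall A : {fset G},
    \sum_(t <- (A `\` A1)%fset) a t <= e'.
  move=> e0; have := n1_ge0 g; rewrite le_eqVlt => /predU1P[g0|g0].
    (* If [n1 g = 0], the majorant sums to zero and no division by [n1 g] is made. *)
    by exists fset0 => A; rewrite aE -g0 mulr0 ltW.
  have [|A1 hA1] := ell1_tail lf (_ : 0 < e' / n1 g); first by rewrite divr_gt0.
  by exists A1 => A; rewrite aE -ler_pdivlMr.
have lim x : exists l : Cplx R, forall (A1 : {fset G}) (e' : R),
    (forall A : {fset G}, \sum_(t <- (A `\` A1)%fset) a t <= e') ->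
    cmod (l - \sum_(t <- A1) mul_term f g s t x) <= e' + e'.
  apply: complex_unordered_sum => // t.
  apply: le_trans (le_mul_term _ _ _ lf lg) _.
  by rewrite ler_wpM2l ?supnorm_ge0// supnorm_le_n1.
have /choice[l lP] := lim.
have -> : ell1_mul sigma f g s = l.
  apply: ell1_mul_unique => e' e0.
  have [|A1 hA1] := tail (e' / 3); first by rewrite divr_gt0.
  exists A1 => A A1A x.
  apply: le_lt_trans (lP x A (e' / 3) _) _; last by lra.
  move=> B; apply: le_trans (hA1 (B `\` A)%fset).
  suff -> : (B `\` A `\` A1 = B `\` A)%fset by [].
  by rewrite fsetDDl (fsetUidPl _ _ A1A).
move=> x; rewrite mulrDl; apply: lP => A.
by rewrite aE ler_wpM2r// n1_ge0.
Qed.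

Lemma ell1_mulP f g s : ell1 f -> ell1 g ->
  usums (mul_term f g s) (ell1_mul sigma f g s).
Proof.
move=> lf lg e e0.
have g0 : 0 < n1 g + 1 by rewrite ltr_wpDl// n1_ge0.
(* The [+ 1] keeps the denominator positive when [n1 g = 0], and still [d * n1 g < e / 3]. *)
pose d := e / 3 / (n1 g + 1).
have d0 : 0 < d by rewrite !divr_gt0.
have dE : d * n1 g + d = e / 3 by rewrite -[X in _ + X]mulr1 -mulrDr divfK ?gt_eqF.
have [A0 hA0] := ell1_tail lf d0.
exists A0 => A A0A x; apply: le_lt_trans (ell1_mul_approx _ lf lg _ _) _.
  move=> B; apply: le_trans (hA0 (B `\` A)%fset).
  suff -> : (B `\` A `\` A0 = B `\` A)%fset by [].
  by rewrite fsetDDl (fsetUidPl _ _ A0A).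
by rewrite mulrDl; lra.
Qed.

Lemma sum_translate_le_n1 g (t : G) (B : {fset G}) : ell1 g ->
  \sum_(s <- B) supnorm (g (t^-1 * s)%g) <= n1 g.
Proof.
move=> lg; apply: le_trans (sum_le_n1 [fset (t^-1 * s)%g | s in B]%fset lg).
rewrite big_imfset //= => x y _ _; exact: mulgI.
Qed.

(** On a finite set [B] of indices all coefficients of the product are approximated by sums over one
    finite [A0]; exchanging the two finite sums and translating the index of [g] gives the bound up
    to [e]. *)
Lemma ell1_mul_ell1 f g : ell1 f -> ell1 g ->
  ell1 (ell1_mul sigma f g) /\ n1 (ell1_mul sigma f g) <= n1 f * n1 g.
Proof.
move=> lf lg; apply: n1_le.
  move=> s; apply: usums_continuous (ell1_mulP _ lf lg) => t.
  by apply: continuous_mul_term => u; exact: ell1_continuous.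
move=> B; apply/ler_addgt0Pr => e e0.
(* The error [(d + d) * n1 g] occurs once for each index in [B], in total [(d + d) * c <= e]. *)
pose c := n1 g * (size (enum_fset B))%:R.
have c0 : 0 < c + 1 by rewrite ltr_wpDl// mulr_ge0 ?n1_ge0.
pose d := e / 2 / (c + 1).
have d0 : 0 < d by rewrite !divr_gt0.
have dE : d * c + d = e / 2 by rewrite -[X in _ + X]mulr1 -mulrDr divfK ?gt_eqF.
have [A0 hA0] := ell1_tail lf d0.
have mule s : supnorm (ell1_mul sigma f g s) <=
    \sum_(t <- A0) supnorm (f t) * supnorm (g (t^-1 * s)%g) + (d + d) * n1 g.
  apply: supnorm_le.
    rewrite addr_ge0// ?sumr_ge0// => [t _|]; first by rewrite mulr_ge0 ?supnorm_ge0.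
    by rewrite mulr_ge0 ?n1_ge0// addr_ge0 ?ltW.
  move=> x; rewrite -[ell1_mul _ _ _ _ _](subrK (\sum_(t <- A0) mul_term f g s t x)).
  apply: le_trans (cmodD _ _) _; rewrite addrC lerD//; last exact: ell1_mul_approx.
  by apply: le_trans (cmod_sum _ _) _; apply: ler_sum => t _; exact: le_mul_term.
apply: le_trans (ler_sum _ (fun s _ => mule s)) _.
rewrite big_split /= lerD//; last first.
  rewrite big_const_seq count_predT iter_addr_0 -mulr_natr -mulrA.
  by rewrite -/c mulrDl; lra.
rewrite exchange_big /=.
apply: (@le_trans _ _ (\sum_(t <- A0) supnorm (f t) * n1 g)).
  apply: ler_sum => t _; rewrite -mulr_sumr ler_wpM2l ?supnorm_ge0//.
  exact: sum_translate_le_n1.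
by rewrite -mulr_suml ler_wpM2r ?n1_ge0// sum_le_n1.
Qed.
End Product.

(** * Linear structure of [ell1], bilinearity of the product, monomials and truncations *)

Section Monomials.
Context (R : realType) (G : groupType) (X : topologicalType).
Context (sigma : G -> X -> X).
Hypothesis Xc : compact [set: X].
Hypothesis sa : homeo_action sigma.
Implicit Types (f g k : G -> X -> Cplx R) (h : X -> Cplx R).

Lemma ell1D f g : ell1 f -> ell1 g -> ell1 (f + g) /\ n1 (f + g) <= n1 f + n1 g.
Proof.
move=> lf lg; apply: n1_le => [s x|A].
  by apply: (@continuousD _ _ _ (f s) (g s)); apply: ell1_continuous.
apply: le_trans (lerD (sum_le_n1 A lf) (sum_le_n1 A lg)).
rewrite -big_split /=; apply: ler_sum => s _; apply: supnormD => //.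
  exact: ell1_continuous lf.
exact: ell1_continuous lg.
Qed.

Lemma ell1Z (a : R[i]) f : ell1 f -> ell1 (a *: f) /\ n1 (a *: f) <= cmod a * n1 f.
Proof.
move=> lf; apply: n1_le => [s x|A].
  apply: (@continuousM _ _ (cst a) (f s)); first exact: cst_continuous.
  exact: ell1_continuous lf x.
apply: le_trans (ler_wpM2l (cmod_ge0 a) (sum_le_n1 A lf)).
rewrite mulr_sumr; apply: ler_sum => s _; apply: supnorm_le.
  by rewrite mulr_ge0 ?cmod_ge0 ?supnorm_ge0.
move=> x; rewrite [(a *: f) s x]/(a * f s x) cmodM ler_wpM2l ?cmod_ge0//.
by apply: le_supnorm => //; exact: ell1_continuous lf.
Qed.

Lemma ell1B f g : ell1 f -> ell1 g -> ell1 (f - g) /\ n1 (f - g) <= n1 f + n1 g.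
Proof.
move=> lf lg; have [lNg nN] := ell1Z (- 1) lg.
rewrite scaleN1r in lNg nN; have [lfg nfg] := ell1D lf lNg.
split=> //; apply: le_trans nfg _; rewrite lerD2l (le_trans nN)//.
by rewrite cmodN cmod1 mul1r.
Qed.

Lemma ell1_0 : ell1 (0 : G -> X -> Cplx R).
Proof.
apply: (@n1_le _ _ _ _ 0 _ _).1 => [s x|A]; first exact: cst_continuous.
by rewrite big1// => s _; exact: supnorm0.
Qed.

Lemma ell1_mulBl f g k : ell1 f -> ell1 g -> ell1 k ->
  ell1_mul sigma (f - g) k = ell1_mul sigma f k - ell1_mul sigma g k.
Proof.
move=> lf lg lk; apply/funext => s; apply: ell1_mul_unique.
have := usumsB (ell1_mulP _ Xc s lf lk) (ell1_mulP _ Xc s lg lk).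
suff -> : mul_term sigma (f - g) k s =
  (fun t => mul_term sigma f k s t - mul_term sigma g k s t) by [].
by apply/funext => t; apply/funext => x; exact: mulrBl.
Qed.

Lemma ell1_mulBr f g k : ell1 f -> ell1 g -> ell1 k ->
  ell1_mul sigma f (g - k) = ell1_mul sigma f g - ell1_mul sigma f k.
Proof.
move=> lf lg lk; apply/funext => s; apply: ell1_mul_unique.
have := usumsB (ell1_mulP _ Xc s lf lg) (ell1_mulP _ Xc s lf lk).
suff -> : mul_term sigma f (g - k) s =
  (fun t => mul_term sigma f g s t - mul_term sigma f k s t) by [].
by apply/funext => t; apply/funext => x; exact: mulrBr.
Qed.

(** Follows from the rule for differences, applied to [(f + g) - g]. *)
Lemma ell1_mulDl f g k : ell1 f -> ell1 g -> ell1 k ->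
  ell1_mul sigma (f + g) k = ell1_mul sigma f k + ell1_mul sigma g k.
Proof.
move=> lf lg lk; have lfg := (ell1D lf lg).1.
by apply: (addIr (- ell1_mul sigma g k)); rewrite -ell1_mulBl// !addrK.
Qed.

Lemma ell1_mulDr f g k : ell1 f -> ell1 g -> ell1 k ->
  ell1_mul sigma f (g + k) = ell1_mul sigma f g + ell1_mul sigma f k.
Proof.
move=> lf lg lk; have lfg := (ell1D lg lk).1.
by apply: (addIr (- ell1_mul sigma f k)); rewrite -ell1_mulBr// !addrK.
Qed.

(* The element [h delta_t]. *)
Definition mono h (t : G) : G -> X -> Cplx R := fun s => if s == t then h else 0.

Lemma monoE h t : mono h t t = h.
Proof. by rewrite /mono eqxx. Qed.

Lemma mono_neq h t s : s != t -> mono h t s = 0.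
Proof. by rewrite /mono => /negbTE->. Qed.

Lemma mono_ell1 h t : continuous h -> ell1 (mono h t) /\ n1 (mono h t) <= supnorm h.
Proof.
move=> ch; apply: n1_le => [s|A].
  by rewrite /mono; case: eqP => [_|_ x]; [exact: ch|exact: cst_continuous].
have [tA|tA] := boolP (t \in A).
  rewrite (big_fsetD1 t) //= monoE big1_seq ?addr0// => s /=.
  by rewrite in_fsetD1 => /andP[/mono_neq-> _]; rewrite supnorm0.
rewrite big1_seq ?supnorm_ge0// => s /= sA.
by rewrite mono_neq ?supnorm0//; apply: contraNN tA => /eqP<-.
Qed.

Lemma ell1_mul_single f g s t :
  (forall u x, u != t -> mul_term sigma f g s u x = 0) ->
  ell1_mul sigma f g s = mul_term sigma f g s t.
Proof.
move=> h0; apply: ell1_mul_unique; apply: (@usums_eventually _ _ _ _ _ [fset t]%fset).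
move=> A x; rewrite fsub1set => tA; rewrite (big_fsetD1 t) //= big1_seq ?addr0//.
by move=> u /=; rewrite in_fsetD1 => /andP[/h0-> _].
Qed.

Lemma mul_monoL h t g s x :
  ell1_mul sigma (mono h t) g s x = h x * g (t^-1 * s)%g (sigma t^-1%g x).
Proof.
rewrite (@ell1_mul_single _ _ _ t) ?/mul_term ?monoE// => u y /mono_neq->.
by rewrite mul0r.
Qed.

(** Only the index [u = s * t^-1] contributes, and [h] is evaluated at [u^-1 = t * s^-1] applied to
    [x]. *)
Lemma mul_monoR f h t s x :
  ell1_mul sigma f (mono h t) s x = f (s * t^-1)%g x * h (sigma (t * s^-1)%g x).
Proof.
rewrite (@ell1_mul_single _ _ _ (s * t^-1)%g) => [|u y ust].
  by rewrite /mul_term !invgM !invgK mulgVK monoE.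
rewrite /mul_term mono_neq ?mulr0//; apply: contraNN ust => /eqP <-.
by rewrite invgM invgK mulVKg.
Qed.

Definition trunc (A : {fset G}) f : G -> X -> Cplx R :=
  fun s => if s \in A then f s else 0.

Lemma trunc_ell1 (A : {fset G}) f : ell1 f -> ell1 (trunc A f).
Proof.
move=> lf; apply: (@n1_le _ _ _ _ (n1 f) _ _).1 => [s|B].
  rewrite /trunc; case: ifP => _; first exact: ell1_continuous.
  by move=> x; exact: cst_continuous.
apply: le_trans (sum_le_n1 B lf); apply: ler_sum => s _.
by rewrite /trunc; case: ifP => // _; rewrite supnorm0 supnorm_ge0.
Qed.

Lemma truncU1 t (A : {fset G}) f : t \notin A ->
  trunc (t |` A)%fset f = mono (f t) t + trunc A f.
Proof.
move=> tA; apply/funext => s.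
suff : trunc (t |` A)%fset f s = mono (f t) t s + trunc A f s by [].
rewrite /mono /trunc in_fset1U.
by have [->|st] /= := eqVneq s t; rewrite ?(negbTE tA) ?addr0 ?add0r.
Qed.

(** The error is a tail of the norm; hence finitely supported elements are dense. *)
Lemma trunc_approx f (e : R) : ell1 f -> 0 < e ->
  exists A, n1 (f - trunc A f) < e.
Proof.
move=> lf e0; have [|A hA] := ell1_tail lf (_ : 0 < e / 2); first by rewrite divr_gt0.
exists A; apply: (@le_lt_trans _ _ (e / 2)); last first.
  by rewrite gtr_pMr// invf_lt1// ltr1n.
have lB := (ell1B lf (trunc_ell1 A lf)).1.
apply: (n1_le _ _).2 => [s|B]; first exact: ell1_continuous.
have BA : (B `\` A `<=` B)%fset by exact: fsubsetDl.
apply: le_trans (hA B).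
rewrite (fsum_setD _ BA) /= [X in _ + X]big1_seq ?addr0 => [|s]; last first.
  rewrite /= !inE => /andP[sBA sB].
  have sA : s \in A by move: sBA; rewrite sB andbT negbK.
  by rewrite (_ : (f - _) s = f s - trunc A f s) // /trunc sA subrr supnorm0.
rewrite big_seq [leRHS]big_seq; apply: ler_sum => s; rewrite inE => /andP[sA _].
by rewrite (_ : (f - _) s = f s - trunc A f s) // /trunc (negbTE sA) subr0.
Qed.

End Monomials.

(** * Norm closures, and a criterion for a closure to be a closed ideal *)

Section ClosedIdeals.
Context (R : realType) (G : groupType) (X : topologicalType).
Context (sigma : G -> X -> X).
Hypothesis Xc : compact [set: X].
Hypothesis sa : homeo_action sigma.
Implicit Types (f g k : G -> X -> Cplx R) (h : X -> Cplx R).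
Implicit Types (I S : set (G -> X -> Cplx R)).

Definition ell1_closure S : set (G -> X -> Cplx R) :=
  [set f | ell1 f /\ forall e : R, 0 < e -> exists2 g, S g & n1 (f - g) < e].

Lemma ell1_normB_lt f g (e : R) : ell1 f -> ell1 g ->
  (ell1_norm (f - g)%R < e%:E)%E = (n1 (f - g) < e).
Proof. by move=> lf lg; rewrite ell1_normE ?lte_fin//; exact: (ell1B Xc lf lg).1. Qed.

Lemma closed_ideal_closure_sub I : closed_ideal sigma I -> ell1_closure I `<=` I.
Proof.
move=> cI f [lf hf]; apply: (closed_ideal_closed cI) => // e /hf[g Ig fg].
by exists g => //; rewrite ell1_normB_lt//; exact: (closed_ideal_sub cI).
Qed.

Lemma sub_ell1_closure S : S `<=` ell1 -> S `<=` ell1_closure S.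
Proof.
move=> Sl f Sf; split; first exact: Sl.
move=> e e0; exists f => //; rewrite subrr.
apply: (le_lt_trans _ e0); apply: (n1_le _ _).2 => [s x|A].
  exact: cst_continuous.
by rewrite big1// => s _; exact: supnorm0.
Qed.

Lemma n1_dist_triangle f g k : ell1 f -> ell1 g -> ell1 k ->
  n1 (f - k) <= n1 (f - g) + n1 (g - k).
Proof.
move=> lf lg lk; rewrite -(subrK g f) -[X in n1 X]addrA subrK.
exact: (ell1D Xc (ell1B Xc lf lg).1 (ell1B Xc lg lk).1).2.
Qed.

Lemma ell1_closure_closed S f : S `<=` ell1 -> ell1 f ->
  (forall e : R, 0 < e -> exists2 g, ell1_closure S g & n1 (f - g) < e) ->
  ell1_closure S f.
Proof.
move=> Sl lf hf; split=> // e e0.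
have e2 : 0 < e / 2 by rewrite divr_gt0.
have [g [lg /(_ _ e2)[k Sk gk]] fg] := hf _ e2.
exists k => //; apply: le_lt_trans (n1_dist_triangle lf lg (Sl _ Sk)) _.
by rewrite (splitr e) ltrD.
Qed.

Section Closure.
Context (S : set (G -> X -> Cplx R)).
Hypothesis Sl : S `<=` ell1.
Hypothesis S0 : S 0.
Hypothesis SD : forall f g, S f -> S g -> S (f + g).
Hypothesis SZ : forall (a : R[i]) f, S f -> S (a *: f).
Hypothesis SMl : forall h t f, continuous h -> S f ->
  S (ell1_mul sigma (mono h t) f).
Hypothesis SMr : forall h t f, continuous h -> S f ->
  S (ell1_mul sigma f (mono h t)).

(** Truncations of [f] are finite sums of monomials, so their products with [g] stay in [S]; these
    products converge to that of [f]. *)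
Let Ml f g : ell1 f -> S g -> ell1_closure S (ell1_mul sigma f g).
Proof.
move=> lf Sg; have lg := Sl Sg; split; first exact: (ell1_mul_ell1 Xc sa lf lg).1.
move=> e e0; have g0 : 0 < n1 g + 1 by rewrite ltr_wpDl// n1_ge0.
have [|A hA] := trunc_approx Xc lf (_ : 0 < e / (n1 g + 1)); first by rewrite divr_gt0.
have lA B : ell1 (trunc B f) by exact: trunc_ell1.
have lfA := (ell1B Xc lf (lA A)).1.
exists (ell1_mul sigma (trunc A f) g).
  elim/finSet_rect: A {hA lfA} => A IH.
  have [->|[t tA]] := fset_0Vmem A.
    (* Zero is written as a monomial so that [SMl] covers the base case. *)
    have -> : trunc fset0 f = mono 0 1%g by apply/funext => s; rewrite /trunc /mono if_same.
    by apply: SMl => // x; exact: cst_continuous.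
  rewrite -(fsetD1K tA) truncU1 ?fsetD11// ell1_mulDl//; last first.
    by apply: (mono_ell1 _ _).1; exact: ell1_continuous.
  apply: SD; first by apply: SMl => //; exact: ell1_continuous.
  by apply: IH; rewrite fproperD1.
rewrite -ell1_mulBl//; apply: le_lt_trans (ell1_mul_ell1 Xc sa lfA lg).2 _.
apply: (@le_lt_trans _ _ (n1 (f - trunc A f) * (n1 g + 1))).
  by rewrite ler_wpM2l ?n1_ge0// lerDl.
by rewrite -ltr_pdivlMr.
Qed.

Let Mr f g : S f -> ell1 g -> ell1_closure S (ell1_mul sigma f g).
Proof.
move=> Sf lg; have lf := Sl Sf; split; first exact: (ell1_mul_ell1 Xc sa lf lg).1.
move=> e e0; have f0 : 0 < n1 f + 1 by rewrite ltr_wpDl// n1_ge0.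
have [|A hA] := trunc_approx Xc lg (_ : 0 < e / (n1 f + 1)); first by rewrite divr_gt0.
have lA B : ell1 (trunc B g) by exact: trunc_ell1.
have lgA := (ell1B Xc lg (lA A)).1.
exists (ell1_mul sigma f (trunc A g)).
  elim/finSet_rect: A {hA lgA} => A IH.
  have [->|[t tA]] := fset_0Vmem A.
    have -> : trunc fset0 g = mono 0 1%g by apply/funext => s; rewrite /trunc /mono if_same.
    by apply: SMr => // x; exact: cst_continuous.
  rewrite -(fsetD1K tA) truncU1 ?fsetD11// ell1_mulDr//; last first.
    by apply: (mono_ell1 _ _).1; exact: ell1_continuous.
  apply: SD; first by apply: SMr => //; exact: ell1_continuous.
  by apply: IH; rewrite fproperD1.
rewrite -ell1_mulBr//; apply: le_lt_trans (ell1_mul_ell1 Xc sa lf lgA).2 _.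
apply: (@le_lt_trans _ _ ((n1 f + 1) * n1 (g - trunc A g))).
  by rewrite ler_wpM2r ?n1_ge0// lerDl.
by rewrite mulrC -ltr_pdivlMr.
Qed.

(** Stability under monomials on both sides suffices: they span a dense subspace and multiplication
    is continuous. *)
Lemma closed_ideal_ell1_closure : closed_ideal sigma (ell1_closure S).
Proof.
split.
- by move=> f [].
- exact: sub_ell1_closure.
- move=> f g [lf hf] [lg hg]; split; first exact: (ell1D Xc lf lg).1.
  move=> e e0; have e2 : 0 < e / 2 by rewrite divr_gt0.
  have [f' Sf' ff'] := hf _ e2; have [g' Sg' gg'] := hg _ e2.
  exists (f' + g'); first exact: SD.
  rewrite opprD addrACA (splitr e).
  apply: le_lt_trans (ell1D Xc (ell1B Xc lf (Sl Sf')).1 (ell1B Xc lg (Sl Sg')).1).2 _.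
  by rewrite ltrD.
- move=> a f [lf hf]; split; first exact: (ell1Z Xc a lf).1.
  move=> e e0; have a0 : 0 < cmod a + 1 by rewrite ltr_wpDl// cmod_ge0.
  have [|g Sg fg] := hf (e / (cmod a + 1)); first by rewrite divr_gt0.
  exists (a *: g); first exact: SZ.
  rewrite -scalerBr; apply: le_lt_trans (ell1Z Xc a (ell1B Xc lf (Sl Sg)).1).2 _.
  apply: (@le_lt_trans _ _ ((cmod a + 1) * n1 (f - g))).
    by rewrite ler_wpM2r ?n1_ge0// lerDl.
  by rewrite mulrC -ltr_pdivlMr.
- move=> f g lf [lg hg]; apply: ell1_closure_closed => //.
    exact: (ell1_mul_ell1 Xc sa lf lg).1.
  move=> e e0; have f0 : 0 < n1 f + 1 by rewrite ltr_wpDl// n1_ge0.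
  have [|g' Sg' gg'] := hg (e / (n1 f + 1)); first by rewrite divr_gt0.
  exists (ell1_mul sigma f g'); first exact: Ml.
  have lg' := Sl Sg'; have lgg := (ell1B Xc lg lg').1.
  rewrite -ell1_mulBr//; apply: le_lt_trans (ell1_mul_ell1 Xc sa lf lgg).2 _.
  apply: (@le_lt_trans _ _ ((n1 f + 1) * n1 (g - g'))).
    by rewrite ler_wpM2r ?n1_ge0// lerDl.
  by rewrite mulrC -ltr_pdivlMr.
- move=> f g [lf hf] lg; apply: ell1_closure_closed => //.
    exact: (ell1_mul_ell1 Xc sa lf lg).1.
  move=> e e0; have g0 : 0 < n1 g + 1 by rewrite ltr_wpDl// n1_ge0.
  have [|f' Sf' ff'] := hf (e / (n1 g + 1)); first by rewrite divr_gt0.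
  exists (ell1_mul sigma f' g); first exact: Mr.
  have lf' := Sl Sf'; have lff := (ell1B Xc lf lf').1.
  rewrite -ell1_mulBl//; apply: le_lt_trans (ell1_mul_ell1 Xc sa lff lg).2 _.
  apply: (@le_lt_trans _ _ (n1 (f - f') * (n1 g + 1))).
    by rewrite ler_wpM2l ?n1_ge0// lerDl.
  by rewrite -ltr_pdivlMr.
- move=> f lf hf; apply: ell1_closure_closed => // e /hf[g cg fg].
  by exists g => //; rewrite -ell1_normB_lt//; case: cg.
Qed.

End Closure.

End ClosedIdeals.

Lemma continuous_mul (K : numFieldType) (T : topologicalType) (f g : T -> K) :
  continuous f -> continuous g -> continuous (fun x => f x * g x).
Proof. by move=> cf cg x; exact: (@continuousM K T f g x (cf x) (cg x)). Qed.

(** * The hull of a closed ideal, and continuous functions vanishing on it *)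

Section Hull.
Context (R : realType) (G : groupType) (X : topologicalType).
Context (sigma : G -> X -> X).
Hypothesis Xc : compact [set: X].
Hypothesis Xh : hausdorff_space X.
Hypothesis sa : homeo_action sigma.
Implicit Types (f g : G -> X -> Cplx R) (h k : X -> Cplx R).
Implicit Types (I : set (G -> X -> Cplx R)).

Lemma urysohn (A B : set X) : closed A -> closed B -> A `&` B = set0 ->
  exists q : X -> R, [/\ continuous q, forall x, 0 <= q x <= 1,
    forall x, A x -> q x = 0 & forall x, B x -> q x = 1].
Proof.
move=> cA cB AB; have nX := compact_normal Xh Xc.
have [q [cq q01 q0 q1]] := (@uniform_separatorP X R A B).1
  ((@normal_separatorP R X).1 nX A B cA cB AB).
exists q; split=> // x.
  by have /= := q01 (q x) (ex_intro2 _ _ x Logic.I erefl); rewrite in_itv.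
  by move=> Ax; exact: q0 (q x) (ex_intro2 _ _ x Ax erefl).
by move=> Bx; exact: q1 (q x) (ex_intro2 _ _ x Bx erefl).
Qed.

Lemma mul_CXl h f s x : ell1_mul sigma (mono h 1%g) f s x = h x * f s x.
Proof. by rewrite mul_monoL invg1 mul1g (homeo_action1 sa). Qed.

Lemma mul_CXr f h s x :
  ell1_mul sigma f (mono h 1%g) s x = f s x * h (sigma s^-1%g x).
Proof. by rewrite mul_monoR invg1 mulg1 mul1g. Qed.

Lemma mono_CX h : continuous h -> CX (mono h 1%g : G -> X -> Cplx R).
Proof.
by move=> ch; split; [exact: (mono_ell1 _ ch).1|move=> s; exact: mono_neq].
Qed.

Lemma monoD h k (t : G) : mono (h + k) t = mono h t + mono k t.
Proof.
apply/funext => s; suff : mono (h + k) t s = mono h t s + mono k t s by [].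
by rewrite /mono; case: eqP; rewrite ?addr0.
Qed.

Lemma monoB h k (t : G) : mono (h - k) t = mono h t - mono k t.
Proof. by apply: (addIr (mono k t)); rewrite -monoD !subrK. Qed.

Lemma mono0 (t : G) : mono (0 : X -> Cplx R) t = 0.
Proof. by apply/funext => s; rewrite /mono if_same. Qed.

Lemma CX_mono f : CX f -> f = mono (f 1%g) 1%g.
Proof.
by move=> [lf f0]; apply/funext => s; rewrite /mono; case: eqP => [->|/eqP/f0].
Qed.

Definition hull I : set X := [set x | forall f, I f -> CX f -> f 1%g x = 0].

Lemma nonzero_near h x : continuous h -> h x <> 0 -> \forall y \near x, h y <> 0.
Proof.
move=> ch hx; have e0 : 0 < cmod (h x).
  by rewrite lt_neqAle cmod_ge0 andbT eq_sym; apply/eqP => /cmod_eq0.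
have /contP/(_ _ e0) := ch x; apply: filterS => y + hy.
by rewrite hy subr0 ltxx.
Qed.

Lemma closed_hull I : closed (hull I).
Proof.
rewrite -openC openE => x /= /existsNP[f /not_implyP[If /not_implyP[Cf fx]]].
have := nonzero_near (ell1_continuous Cf.1) fx.
by apply: filterS => y fy /(_ f If Cf).
Qed.

(** Conjugating [f] by the monomials with coefficient 1 at [s^-1] and [s] gives an element of [I] in
    [CX] whose coefficient at the identity is [f 1 \o sigma s]. *)
Lemma invariant_hull I : closed_ideal sigma I -> invariant_set sigma (hull I).
Proof.
move=> cI s x Dx f If Cf.
have c1 t : ell1 (mono 1 t : G -> X -> Cplx R).
  by apply: (mono_ell1 _ _).1 => y; exact: cst_continuous.
pose g := ell1_mul sigma (ell1_mul sigma (mono 1 s^-1%g) f) (mono 1 s).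
have gE t y : g t y = f (s * (t * s^-1))%g (sigma s y).
  by rewrite /g mul_monoR mulr1 mul_monoL mul1r invgK.
have Ig : I g by apply: closed_idealMr => //; exact: closed_idealMl.
have Cg : CX g.
  split=> [|t t1]; first exact: (closed_ideal_sub cI).
  apply/funext => y; rewrite gE Cf.2//; apply: contraNN t1 => /eqP E.
  by rewrite -(mulgK s^-1%g t) -(mulKg s (t * s^-1)%g) E mulg1 invgK mulVg.
by have := Dx g Ig Cg; rewrite gE mul1g mulgV.
Qed.

Lemma ideal_mono_mul I h k : closed_ideal sigma I -> continuous h ->
  I (mono k 1%g) -> I (mono (fun x => h x * k x) 1%g).
Proof.
move=> cI ch Ik; have -> : mono (fun x => h x * k x) 1%g =
    ell1_mul sigma (mono h 1%g) (mono k 1%g).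
  apply/funext => s; apply/funext => x; rewrite mul_CXl /mono.
  by case: eqP => // _; rewrite mulr0.
exact: (closed_idealMl cI (mono_ell1 _ ch).1 Ik).
Qed.

(** Multiplying [f 1] by its conjugate gives its squared modulus, which stays in [I]; the factor [a]
    normalises its value at [x] to 2. *)
Lemma ideal_positive I x : closed_ideal sigma I -> ~ hull I x ->
  exists H : X -> R, [/\ continuous H, forall y, 0 <= H y, 1 < H x &
    I (mono (fun y => (H y)%:C : Cplx R) 1%g)].
Proof.
move=> cI /existsNP[f /not_implyP[If /not_implyP[Cf fx]]].
have c0 : 0 < cmod (f 1%g x) by rewrite lt_neqAle cmod_ge0 andbT eq_sym; apply/eqP => /cmod_eq0.
have cf : continuous (f 1%g) := ell1_continuous Cf.1.
pose a := 2 / cmod (f 1%g x) ^+ 2.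
have a0 : 0 < a by rewrite divr_gt0// exprn_gt0.
exists (fun y => a * cmod (f 1%g y) ^+ 2); split.
- apply: (@continuous_mul _ _ (cst a)); first exact: cst_continuous.
  by apply: continuous_mul; exact: continuous_cmod.
- by move=> y; rewrite mulr_ge0 ?exprn_ge0 ?cmod_ge0// ltW.
- by rewrite divfK ?ltr1n// expf_eq0 /= gt_eqF.
have -> : (fun y => (a * cmod (f 1%g y) ^+ 2)%:C : Cplx R) =
    (fun y => (a%:C * (f 1%g y)^*%C) * f 1%g y).
  apply/funext => y; rewrite rmorphM /= -mul_conjE -mulrA; congr (_ * _).
  exact: mulrC.
apply: (ideal_mono_mul cI); last by rewrite -CX_mono.
apply: (@continuous_mul _ _ (cst (a%:C : Cplx R))); first exact: cst_continuous.
exact: continuous_conj.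
Qed.

Lemma hull_kernel I h : closed_ideal sigma I -> continuous h ->
  (forall x, hull I x -> h x = 0) -> I (mono h 1%g).
Proof.
move=> cI ch h0.
apply: (closed_ideal_closure_sub Xc cI); split; first exact: (mono_ell1 _ ch).1.
move=> e e0; have e2 : 0 < e / 2 by rewrite divr_gt0.
pose K := [set x | e / 2 <= cmod (h x)].
have cK : compact K.
  apply: (subclosed_compact _ Xc) => //.
  rewrite (_ : K = (@cmod R \o h) @^-1` [set r | e / 2 <= r]) //.
  by apply: preimage_closed => [x _|]; [exact: continuous_cmod|exact: closed_ge].
(* The nonnegative functions in [I] are closed under addition, so compactness
   gives one of them, [H0], that exceeds 1 on [K]; then [h n H0 / (1 + n H0)] is
   in [I] and uniformly close to [h] for large [n]. *)
pose cone (H : X -> R) := [/\ continuous H, forall y, 0 <= H y &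
  I (mono (fun y => (H y)%:C : Cplx R) 1%g)].
have coneD H H' : cone H -> cone H' -> cone (H + H').
  move=> [cH H0 IH] [cH' H'0 IH']; split=> [y|y|].
  - by apply: continuousD; [exact: cH|exact: cH'].
  - by rewrite addr_ge0.
  - have := closed_idealD cI IH IH'; rewrite -monoD; congr (I (mono _ _)).
    apply/funext => y; exact: (esym (rmorphD (real_complex R) (H y) (H' y))).
have cone0 : cone 0.
  split=> [y|y|]; [exact: cst_continuous|by []|].
  by rewrite (_ : (fun y => _) = 0) // mono0; exact: closed_ideal0 cI.
(* A set is in [F] when it contains all functions above some member of [cone]. The covering form of
   compactness, used with this filter, replaces the choice of a finite subcover and the summation
   over it. *)
pose F := filter_from cone (fun H => [set H' : X -> R | forall y, H y <= H' y]).
have FF : Filter F.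
  apply: filter_from_filter => [|H H' coneH coneH']; first by exists 0.
  exists (H + H'); first exact: coneD.
  move=> H'' le; split=> y; apply: le_trans (le y).
    by rewrite [leRHS]/(H y + H' y) lerDl; case: coneH'.
  by rewrite [leRHS]/(H y + H' y) lerDr; case: coneH.
have [H0 [cH0 H00 IH0] /(_ H0 (fun=> lexx _)) KH0] : F [set H | K `<=` [set y | 1 < H y]].
  apply: ((compact_near_coveringP K).1 cK (X -> R) F (fun H y => 1 < H y) FF).
  move=> x Kx; have [|H [cH H0 Hx IH]] := ideal_positive cI (_ : ~ hull I x).
    by move=> /h0 hx; move: Kx; rewrite /K /= hx cmod0 leNgt e2.
  exists ([set y | 1 < H y], [set H' : X -> R | forall y, H y <= H' y]).
    split=> /=; last by exists H.
    by have /cvgr_gt/(_ _ Hx) := cH x.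
  by move=> [y H'] [/= Hy le]; exact: lt_le_trans Hy (le y).
(* Since [supnorm h = n * (e / 2)] and [H0 > 1] on [K], the error [|h| / (1 + n * H0)] is at most
   [e / 2] there; off [K] already [|h| < e / 2]. *)
pose n := supnorm h / (e / 2).
have n0 : 0 <= n by rewrite divr_ge0 ?supnorm_ge0// ltW.
have pos y : 0 < 1 + n * H0 y by rewrite ltr_pwDl// mulr_ge0.
pose r y : R := n / (1 + n * H0 y).
have cr : continuous r.
  apply: (@continuous_mul _ _ (cst n)); first exact: cst_continuous.
  move=> y; apply: (@continuousV R X (fun y => 1 + n * H0 y)); first by rewrite gt_eqF.
  apply: (@continuousD R R^o X (cst 1) (fun y => n * H0 y) y); first exact: cst_continuous.
  by apply: (@continuous_mul _ _ (cst n)); [exact: cst_continuous|exact: cH0].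
pose k y : Cplx R := h y * (r y)%:C.
have ck : continuous k.
  by apply: continuous_mul; [exact: ch|exact: continuous_ofR].
exists (mono (fun y => k y * (H0 y)%:C) 1%g); first exact: ideal_mono_mul.
have ckH : continuous (fun y => k y * (H0 y)%:C : Cplx R).
  by apply: continuous_mul; [exact: ck|exact: continuous_ofR].
rewrite -monoB.
have ckB : continuous (h - (fun y => k y * (H0 y)%:C : Cplx R)).
  by move=> y; apply: continuousB; [exact: ch|exact: ckH].
apply: le_lt_trans (mono_ell1 _ ckB).2 _.
apply: (@le_lt_trans _ _ (e / 2)); last by rewrite gtr_pMr// invf_lt1// ltr1n.
apply: supnorm_le => [|y]; first exact: ltW.
have -> : (h - (fun y => k y * (H0 y)%:C)) y = h y * ((1 + n * H0 y)^-1)%:C.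
  have -> : (1 + n * H0 y)^-1 = 1 - r y * H0 y.
    by rewrite /r; field; rewrite gt_eqF.
  by rewrite rmorphB rmorph1 rmorphM mulrBr mulr1 mulrA.
rewrite cmodM cmodR gtr0_norm ?invr_gt0// ler_pdivrMr//.
have [Ky|] := leP (e / 2) (cmod (h y)).
  have Hy : 1 < H0 y := KH0 y Ky.
  apply: le_trans (le_supnorm Xc y ch) _.
  have -> : supnorm h = e / 2 * n by rewrite /n mulrC divfK// gt_eqF.
  rewrite ler_wpM2l ?ltW//.
  apply: (@le_lt_trans _ _ (n * H0 y)); first by rewrite ler_peMr// ltW.
  by rewrite ltrDr.
move=> hy; apply: le_trans (ltW hy) _; apply: ler_peMr; first exact: ltW.
by rewrite lerDl mulr_ge0.
Qed.

End Hull.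

(** * Localisation of elements of an ideal at points with trivial stabiliser *)

Section FreePoints.
Context (R : realType) (G : groupType) (X : topologicalType).
Context (sigma : G -> X -> X).
Hypothesis Xc : compact [set: X].
Hypothesis Xh : hausdorff_space X.
Hypothesis sa : homeo_action sigma.
Implicit Types (f g r : G -> X -> Cplx R) (h : X -> Cplx R) (p q : X -> R).
Implicit Types (I : set (G -> X -> Cplx R)).

Definition ofR p : X -> Cplx R := fun x => (p x)%:C.

(** From [K = P K = g K + (P - g) K], an approximation [i] of [K] in [I] yields [g K + (P - g) i],
    again in [I], with error [(P - g) (K - i)], for which the bound is halved. *)
Lemma ideal_absorb I g p k : closed_ideal sigma I -> I g ->
  continuous p -> continuous k -> (forall y, p y * k y = k y) ->
  n1 (mono (ofR p) 1%g - g) <= 2^-1 -> I (mono (ofR k) 1%g).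
Proof.
move=> cI Ig cp ck pk small.
set P := mono (ofR p) 1%g in small *; set K := mono (ofR k) 1%g.
have lP : ell1 P by apply: (mono_ell1 _ _).1; exact: continuous_ofR.
have lK : ell1 K by apply: (mono_ell1 _ _).1; exact: continuous_ofR.
have lI f : I f -> ell1 f by exact: (closed_ideal_sub cI).
have PK : ell1_mul sigma P K = K.
  apply/funext => s; apply/funext => x; rewrite (mul_CXl sa) /K /mono.
  by case: eqP => _; rewrite ?mulr0// -rmorphM /= pk.
have [lPg _] := ell1B Xc lP (lI _ Ig).
have approx n : exists2 i, I i & n1 (K - i) <= 2^-1 ^+ n * n1 K.
  elim: n => [|n [i Ii hi]].
    by exists 0; [exact: closed_ideal0 cI|rewrite subr0 expr0 mul1r].
  have lKi := (ell1B Xc lK (lI _ Ii)).1.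
  exists (ell1_mul sigma g K + ell1_mul sigma (P - g) i).
    by apply: (closed_idealD cI); [exact: (closed_idealMr cI)|exact: (closed_idealMl cI)].
  have -> : K - (ell1_mul sigma g K + ell1_mul sigma (P - g) i) =
      ell1_mul sigma (P - g) (K - i).
    rewrite (ell1_mulBr sigma Xc lPg lK (lI _ Ii)) (ell1_mulBl sigma Xc lP (lI _ Ig) lK) PK.
    by rewrite opprD addrA.
  apply: le_trans (ell1_mul_ell1 Xc sa lPg lKi).2 _.
  by rewrite exprS -mulrA ler_pM ?n1_ge0.
apply: (closed_ideal_closure_sub Xc cI); split=> // e e0.
(* Here [n1 K / e < n < 2 ^ n], so [n] halvings bring the error below [e]. *)
pose n := Num.bound (n1 K / e).
have hn : n1 K / e < n%:R by apply: archi_boundP; rewrite divr_ge0 ?n1_ge0// ltW.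
have [i Ii hi] := approx n; exists i => //; apply: le_lt_trans hi _.
rewrite exprVn mulrC ltr_pdivrMr ?exprn_gt0//.
rewrite -ltr_pdivrMl// mulrC; apply: lt_trans hn _.
by rewrite -natrX ltr_nat ltn_expl.
Qed.

(** The coefficient of [p f q] at [s] is [p y * f s y * q (s^-1 y)]. Freeness of [x] allows [q] to
    be 1 at [x] and 0 at its translates [s^-1 x] for the finitely many [s <> 1] that matter; the
    other coefficients have small total norm. *)
Lemma free_cutoff f x (c : Cplx R) : ell1 f -> f 1%g x = c -> c <> 0 ->
  (forall s, s != 1%g -> sigma s x <> x) ->
  exists p q, [/\ continuous p, continuous q,
    \forall y \near x, p y = 1 &
    n1 (mono (ofR p) 1%g -
        c^-1 *: ell1_mul sigma (ell1_mul sigma (mono (ofR p) 1%g) f) (mono (ofR q) 1%g))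
    <= 2^-1].
Proof.
move=> lf fx /eqP c0 free.
have cc0 : 0 < cmod c.
  rewrite lt_neqAle cmod_ge0 andbT eq_sym.
  by apply: contraNN c0 => /eqP/cmod_eq0/eqP.
(* The coefficient at 1, those in [F] and those outside [F] cost at most [d] each, within the
   allowance [cmod c / 2 = 4 d]. *)
pose d := cmod c / 8; have d0 : 0 < d by rewrite divr_gt0.
have [F hF] := ell1_tail lf d0.
have N0 : 0 < n1 f + 1 by rewrite ltr_wpDl// n1_ge0.
pose de := d / (n1 f + 1).
have de0 : 0 < de by rewrite divr_gt0.
have deE : de * n1 f + de = d by rewrite -[X in _ + X]mulr1 -mulrDr divfK ?gt_eqF.
have acc := hausdorff_accessible Xh.
pose Z := [set sigma t^-1%g x | t in [set t | t \in F /\ t != 1%g]].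
have clZ : closed Z.
  apply: accessible_finite_set_closed.1 => //; apply: finite_image.
  by apply: sub_finite_set (finite_fset F) => t [].
have [||q [cq q01 qZ qx]] := urysohn R Xc Xh clZ (_ : closed [set x]).
- exact: accessible_closed_set1.
- apply/seteqP; split=> // y [[t [_ t1] <-]] /= tx.
  by apply: free tx; rewrite -eqg_inv invgK invg1.
have nearF : \forall y \near x, forall t, t \in F -> t != 1%g -> q (sigma t^-1%g y) < de.
  (* Induction on a list intersects the finitely many neighbourhoods, one for each [t] in [F]. *)
  suff : forall l : seq G, {subset l <= F} -> \forall y \near x, forall t, t \in l ->
      t != 1%g -> q (sigma t^-1%g y) < de by apply.
  elim=> [_|t l IH tF]; first exact: filterE.
  have {}/IH : {subset l <= F} by move=> u ul; apply: tF; rewrite inE ul orbT.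
  have [->|t1] := eqVneq t 1%g.
    apply: filterS => y hy u; rewrite inE => /predU1P[->|]; last exact: hy.
    by rewrite eqxx.
  have cqt : continuous (q \o sigma t^-1%g).
    move=> y; apply: (@continuous_comp _ _ _ (sigma t^-1%g) q); last exact: cq.
    exact: (homeo_action_continuous sa).
  have /cvgr_lt/(_ de) := cqt x; rewrite /= qZ; last first.
    by exists t => //; split=> //; apply: tF; rewrite inE eqxx.
  move=> /(_ de0); apply: filterS2 => y qy hy u.
  by rewrite inE => /predU1P[->|] //; exact: hy.
have near1 : \forall y \near x, cmod (c - f 1%g y * (q y)%:C) < d.
  have cfq : continuous (fun y => f 1%g y * (q y)%:C : Cplx R).
    by apply: continuous_mul; [exact: ell1_continuous|exact: continuous_ofR].
  by have /contP/(_ _ d0) := cfq x; rewrite fx qx// mulr1.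
have := @filterI _ _ (nbhs_filter x) _ _ near1 nearF.
rewrite nbhsE => -[U [oU Ux] UV].
have [|||p0 [cp0 p01 p0U p0x]] := urysohn R Xc Xh (_ : closed (~` U)) (_ : closed [set x]).
- exact: open_closedC.
- exact: accessible_closed_set1.
- by apply/seteqP; split=> y //= [nU yx]; apply: nU; rewrite yx.
(* Doubling and capping makes [p] equal to 1 on a whole neighbourhood of [x], namely where
   [p0 > 1/2]. *)
pose p y := Num.min 1 (2 * p0 y).
have cp : continuous p.
  move=> y; apply: (@continuous_min R X (cst 1) (fun y => 2 * p0 y)).
    exact: cst_continuous.
  by apply: (@continuous_mul _ _ (cst 2)) => //; exact: cst_continuous.
have pge0 y : 0 <= p y by rewrite le_min ler01 mulr_ge0//; have /andP[] := p01 y.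
have ple1 y : p y <= 1 by rewrite ge_min lexx.
have pU y : ~ U y -> p y = 0.
  by move=> nU; rewrite /p p0U// mulr0; apply/min_idPr; exact: ler01.
have p1 : \forall y \near x, p y = 1.
  have /cvgr_gt/(_ 2^-1) := cp0 x; rewrite p0x// invf_lt1// ltr1n => /(_ isT).
  apply: filterS => y hy; apply/min_idPl; rewrite -ler_pdivrMl// mulr1.
  exact: ltW.
exists p, q; split=> //.
have lm (u : X -> R) : continuous u -> ell1 (mono (ofR u) 1%g : G -> X -> Cplx R).
  by move=> cu; apply: (mono_ell1 _ _).1; exact: continuous_ofR.
set g := ell1_mul _ _ _.
have lg : ell1 g.
  apply: (ell1_mul_ell1 Xc sa _ (lm _ cq)).1.
  exact: (ell1_mul_ell1 Xc sa (lm _ cp) lf).1.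
have gE s y : g s y = (p y)%:C * f s y * (q (sigma s^-1%g y))%:C.
  by rewrite /g mul_CXr (mul_CXl sa).
have [lr _] := ell1B Xc (lm _ cp) (ell1Z Xc c^-1 lg).1.
(* The three summands bound, up to the factor [1 / cmod c], the coefficient at 1, those in [F]
   (where [q < de] at the translate) and those outside [F]. *)
pose b s : R := (if s == 1%g then d else 0) +
  (de * supnorm (f s) + (if s \in F then 0 else supnorm (f s))).
have b1 s : 0 <= (if s == 1%g :> G then d else 0) by case: ifP => // _; exact: ltW.
have b2 s : 0 <= de * supnorm (f s) by rewrite mulr_ge0 ?supnorm_ge0 ?ltW.
have b3 s : 0 <= (if s \in F then 0 else supnorm (f s)).
  by case: ifP => // _; exact: supnorm_ge0.
have rb s : supnorm ((mono (ofR p) 1%g - c^-1 *: g) s) <= (cmod c)^-1 * b s.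
  apply: supnorm_le => [|y]; first by rewrite mulr_ge0 ?invr_ge0 ?cmod_ge0 ?addr_ge0.
  rewrite [X in cmod X](_ : _ = mono (ofR p) 1%g s y - c^-1 * g s y) // gE.
  have [Uy|/pU py] := pselect (U y); last first.
    rewrite /mono /ofR; case: ifP => _; rewrite ?py !mul0r mulr0 subr0 cmod0;
    by rewrite mulr_ge0 ?invr_ge0 ?cmod_ge0 ?addr_ge0.
  have [y1 yF] := UV y Uy.
  have pM (a w : R) : 0 <= a -> a <= w -> p y * a <= w.
    by move=> a0; apply: le_trans; rewrite ler_piMl.
  have [s1|s1] := eqVneq s 1%g.
    rewrite s1 monoE invg1 (homeo_action1 sa).
    have -> : ofR p y - c^-1 * ((p y)%:C * f 1%g y * (q y)%:C) =
        c^-1 * ((p y)%:C * (c - f 1%g y * (q y)%:C)) by rewrite /ofR; field.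
    rewrite cmodM cmodV ler_wpM2l ?invr_ge0 ?cmod_ge0// cmodM cmodR ger0_norm//.
    apply: pM; rewrite ?cmod_ge0// (le_trans (ltW y1))// /b eqxx lerDl.
    exact: addr_ge0.
  rewrite mono_neq// sub0r cmodN cmodM cmodV ler_wpM2l ?invr_ge0 ?cmod_ge0//.
  rewrite -mulrA cmodM cmodR ger0_norm//; apply: pM; first exact: cmod_ge0.
  rewrite cmodM cmodR; have /andP[q0 q1] := q01 (sigma s^-1%g y).
  rewrite ger0_norm// /b (negbTE s1) add0r mulrC.
  have hf : cmod (f s y) <= supnorm (f s) by apply: le_supnorm => //; exact: ell1_continuous.
  have [sF|sF] := boolP (s \in F).
    by rewrite addr0 ler_pM ?cmod_ge0// ltW// yF.
  apply: (@le_trans _ _ (supnorm (f s))); last by rewrite lerDr.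
  by apply: le_trans hf; rewrite ler_piMl ?cmod_ge0.
apply: (n1_le _ _).2 => [s|A]; first exact: ell1_continuous.
apply: le_trans (ler_sum _ (fun s _ => rb s)) _.
rewrite -mulr_sumr ler_pdivrMl//.
have -> : cmod c * 2^-1 = d + (d + d) + d by rewrite /d; lra.
rewrite !big_split /=; apply: ler_wpDr; first exact: ltW.
apply: lerD; last first.
  apply: lerD.
    rewrite -mulr_sumr; apply: (@le_trans _ _ (de * n1 f)); last lra.
    by apply: ler_wpM2l; [exact: ltW|exact: sum_le_n1].
  apply: le_trans (hF A); have BA : (A `\` F `<=` A)%fset by exact: fsubsetDl.
  rewrite (fsum_setD _ BA) /= [X in _ + X]big1_seq ?addr0 => [|s]; last first.
    by rewrite /= !inE => /andP[+ sA]; rewrite sA andbT negbK => ->.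
  rewrite big_seq [leRHS]big_seq; apply: ler_sum => s; rewrite inE => /andP[sF _].
  by rewrite (negbTE sF).
have [tA|tA] := boolP (1%g \in A).
  rewrite (big_fsetD1 1%g) //= eqxx big1_seq ?addr0// => s /=.
  by rewrite in_fsetD1 => /andP[/negbTE->].
rewrite big1_seq ?ltW// => s /= sA.
by case: eqP => // s1; move: sA; rewrite s1 (negbTE tA).
Qed.

(** A function [k] supported where [p = 1] satisfies [p k = k], so [ideal_absorb] puts it in [I],
    although [k x = 1]. *)
Lemma free_notin_hull I f x : closed_ideal sigma I -> I f -> f 1%g x <> 0 ->
  (forall s, s != 1%g -> sigma s x <> x) -> ~ hull I x.
Proof.
move=> cI If fx free Dx.
have lf : ell1 f by exact: (closed_ideal_sub cI).
have [p [q [cp cq p1 small]]] := free_cutoff lf erefl fx free.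
have lm (u : X -> R) : continuous u -> ell1 (mono (ofR u) 1%g : G -> X -> Cplx R).
  by move=> cu; apply: (mono_ell1 _ _).1; exact: continuous_ofR.
have := p1; rewrite /prop_near1 nbhsE => -[U [oU Ux] Up].
have [|||k [ck _ k0 k1]] := urysohn R Xc Xh (_ : closed (~` U)) (_ : closed [set x]).
- exact: open_closedC.
- exact/accessible_closed_set1/hausdorff_accessible.
- by apply/seteqP; split=> y //= [nU yx]; apply: nU; rewrite yx.
have : I (mono (ofR k) 1%g).
  apply: (ideal_absorb cI _ cp ck _ small).
    apply: (closed_idealZ cI); apply: (closed_idealMr cI); last exact: lm.
    by apply: (closed_idealMl cI); first exact: lm.
  move=> y; have [/Up->|/k0->] := pselect (U y); by rewrite ?mul1r ?mulr0.
move=> /Dx/(_ (mono_CX _ (continuous_ofR ck))).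
by rewrite monoE /ofR k1// => /complexI/eqP; rewrite oner_eq0.
Qed.

End FreePoints.

(** * Ideals of elements vanishing on a closed invariant set *)

Section Vanishing.
Context (R : realType) (G : groupType) (X : topologicalType).
Context (sigma : G -> X -> X).
Hypothesis Xc : compact [set: X].
Hypothesis Xh : hausdorff_space X.
Hypothesis sa : homeo_action sigma.
Implicit Types (f g : G -> X -> Cplx R) (h : X -> Cplx R).
Implicit Types (I J : set (G -> X -> Cplx R)).

(** The kernel of the restriction of all coefficients to [D]. *)
Definition vanishing (D : set X) : set (G -> X -> Cplx R) :=
  [set f | ell1 f /\ forall s x, D x -> f s x = 0].

Lemma closed_ideal_vanishing (D : set X) : invariant_set sigma D ->
  closed_ideal sigma (vanishing D).
Proof.
(* Evaluation at a point is norm continuous, so the set equals its closure and the criterion with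
   monomials applies. *)
move=> invD; have VE : vanishing D = ell1_closure (vanishing D).
  apply/seteqP; split=> [|f [lf hf]].
    by apply: (sub_ell1_closure) => f [].
  split=> // s x Dx; apply: cmod_eq0; apply/eqP; rewrite eq_le cmod_ge0 andbT.
  apply/ler_addgt0Pr => e e0; have [g [lg g0] fg] := hf e e0.
  have lfg := (ell1B Xc lf lg).1.
  have -> : f s x = (f - g) s x.
    by have -> : (f - g) s x = f s x - g s x by []; rewrite g0// subr0.
  rewrite add0r (le_trans _ (ltW fg))// (le_trans _ (supnorm_le_n1 s lfg))//.
  by apply: le_supnorm => //; exact: ell1_continuous.
have lm h (t : G) : continuous h -> ell1 (mono h t) by move=> /mono_ell1-/(_ G t)[].
rewrite VE; apply: (closed_ideal_ell1_closure Xc sa).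
- by move=> f [].
- by split=> //; exact: ell1_0.
- move=> f g [lf f0] [lg g0]; split; first exact: (ell1D Xc lf lg).1.
  by move=> s x Dx; have -> : (f + g) s x = f s x + g s x by []; rewrite f0// g0// addr0.
- move=> a f [lf f0]; split; first exact: (ell1Z Xc a lf).1.
  by move=> s x Dx; have -> : (a *: f) s x = a * f s x by []; rewrite f0// mulr0.
- move=> h t f ch [lf f0]; split; first exact: (ell1_mul_ell1 Xc sa (lm h t ch) lf).1.
  by move=> s x Dx; rewrite mul_monoL f0 ?mulr0//; exact: invD.
- move=> h t f ch [lf f0]; split; first exact: (ell1_mul_ell1 Xc sa lf (lm h t ch)).1.
  by move=> s x Dx; rewrite mul_monoR f0 ?mul0r.
Qed.

(** Each coefficient [f t] lies in [I] by [hull_kernel], hence so does the monomial [mono (f t) t];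
    truncations of [f] are sums of these. *)
Lemma vanishing_hull_sub I : closed_ideal sigma I -> vanishing (hull I) `<=` I.
Proof.
move=> cI f [lf f0]; apply: (closed_ideal_closure_sub Xc cI); split=> // e e0.
have [A hA] := trunc_approx Xc lf e0; exists (trunc A f) => //.
have If t : I (mono (f t) t).
  have <- : ell1_mul sigma (mono (f t) 1%g) (mono 1 t) = mono (f t) t.
    apply/funext => s; apply/funext => x; rewrite (mul_CXl sa) /mono.
    by case: eqP; rewrite ?mulr1 ?mulr0.
  apply: (closed_idealMr cI); last first.
    by apply: (mono_ell1 _ _).1 => x; exact: cst_continuous.
  apply: (hull_kernel Xc sa cI) => [|x]; first exact: ell1_continuous.
  exact: f0.
elim/finSet_rect: A {hA} => A IH; have [->|[t tA]] := fset_0Vmem A.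
  have -> : trunc fset0 f = 0 by apply/funext.
  exact: closed_ideal0 cI.
rewrite -(fsetD1K tA) truncU1 ?fsetD11//; apply: (closed_idealD cI) => //.
by apply: IH; rewrite fproperD1.
Qed.

Lemma vanishing_hull_CX I : closed_ideal sigma I ->
  vanishing (hull I) `&` CX = I `&` CX.
Proof.
move=> cI; apply/seteqP; split=> f [If Cf]; split=> //; first exact: vanishing_hull_sub.
split=> [|s x Dx]; first exact: Cf.1.
by have [->|/Cf.2->] := eqVneq s 1%g; first exact: Dx.
Qed.

Lemma hull_eq I J : I `&` CX = J `&` CX -> hull I = hull J.
Proof.
move=> IJ; apply/seteqP; split=> x Dx f If Cf.
  by apply: Dx => //; have : (J `&` CX) f by []; rewrite -IJ => -[].
by apply: Dx => //; have : (I `&` CX) f by []; rewrite IJ => -[].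
Qed.

Lemma residually_free_vanishing I : residually_topologically_free sigma ->
  closed_ideal sigma I -> I = vanishing (hull I).
Proof.
move=> rtf cI; apply/seteqP; split; last exact: vanishing_hull_sub.
have lI f : I f -> ell1 f by exact: (closed_ideal_sub cI).
have van1 f x : I f -> hull I x -> f 1%g x = 0.
  move=> If Dx; apply: contrapT => fx.
  have df := rtf _ (invariant_hull cI) (@closed_hull _ _ _ I).
  have cf : continuous (f 1%g) by apply: ell1_continuous; exact: lI.
  (* [O] is relatively open in the hull and contains [x]; by density it contains a point that is
     free for the restricted action, hence for [sigma]. *)
  pose O := [set y : hull I | f 1%g (set_val y) <> 0].
  have [||y [/= fy yfree]] := df O.
  - by exists (exist _ x (mem_set Dx)).
  - have oU : open [set y | f 1%g y <> 0].
      by rewrite openE => y fy; exact: nonzero_near.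
    by apply: open_comp oU => z _; exact: initial_continuous.
  apply: (free_notin_hull Xc Xh sa cI If fy) (set_valP y) => s s1 sy.
  by apply: (yfree s s1); apply: val_inj.
move=> f If; split; first exact: lI.
move=> s x Dx.
(* Right multiplication by this monomial moves the coefficient at [s] to the identity. *)
have c1 : ell1 (mono 1 s^-1%g : G -> X -> Cplx R).
  by apply: (mono_ell1 _ _).1 => y; exact: cst_continuous.
have := van1 _ _ (closed_idealMr cI If c1) Dx.
by rewrite mul_monoR mulr1 invgK mul1g.
Qed.

End Vanishing.

(** * The Baire category theorem relative to a closed subset *)

Section Baire.
Context (X : topologicalType).
Hypothesis Xc : compact [set: X].
Hypothesis Xh : hausdorff_space X.

Lemma shrink_open (W : set X) z : open W -> W z ->
  exists V : set X, [/\ open V, V z & closure V `<=` W].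
Proof.
move=> oW Wz; have cz : closed [set z].
  exact/accessible_closed_set1/hausdorff_accessible.
have [|B /(_ z erefl) zB BW] := compact_normal Xh Xc cz (_ : set_nbhs [set z] W).
  by move=> _ ->; exact: open_nbhs_nbhs.
exists (interior B); split=> //; first exact: open_interior.
by apply: subset_trans BW; apply: closureS; exact: interior_subset.
Qed.

(** Otherwise nested open sets [V n] meeting [D] exist with the closure of [V n.+1] inside [V n] and
    off [C n]. Compactness gives a point of [D] in every [V n], so in [U] but in no [C n]. *)
Lemma compact_hausdorff_Baire (D U : set X) (C : nat -> set X) :
  closed D -> open U -> D `&` U !=set0 -> (forall n, closed (C n)) ->
  D `&` U `<=` \bigcup_n C n ->
  exists n (V : set X), [/\ open V, D `&` V !=set0 & D `&` V `<=` C n].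
Proof.
move=> clD oU DU clC DUC; apply: contrapT => noV.
pose good (V : set X) := open V /\ D `&` V !=set0.
(* The hypothesis [good] sits under the existential so that [choice] yields a total function; [set0]
   is the default. *)
have step (nV : nat * set X) : exists V', good nV.2 ->
    good V' /\ closure V' `<=` nV.2 `&` ~` C nV.1.
  have [[oV DV]|] := pselect (good nV.2); last by exists set0.
  have [z [[Dz Vz] nCz]] : exists z, (D `&` nV.2) z /\ ~ C nV.1 z.
    apply: contrapT => /forallNP hz; apply: noV; exists nV.1, nV.2; split=> // z DVz.
    by apply: contrapT => nCz; apply: (hz z).
  have [||V' [oV' V'z clV']] := @shrink_open (nV.2 `&` ~` C nV.1) z.
  - by apply: openI => //; exact: closed_openC.
  - by split.
  by exists V' => _; split=> //; split=> //; exists z.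
have [F FP] := choice step.
pose V := fix V n := if n is m.+1 then F (m, V m) else U.
have goodV n : good (V n).
  by elim: n => [|n IH]; [split|exact: (FP (n, V n) IH).1].
have clV n : closure (V n.+1) `<=` V n `&` ~` C n := (FP (n, V n) (goodV n)).2.
have subV m n : (m <= n)%N -> V n `<=` V m.
  elim: n => [|n IH]; first by rewrite leqn0 => /eqP->.
  rewrite leq_eqVlt => /predU1P[->//|/IH]; apply: subset_trans => x Vx.
  by have [] := clV n x (subset_closure Vx).
pose B := filter_from [set: nat] (fun n => D `&` V n).
have BF : ProperFilter B.
  apply: filter_from_proper; last by move=> n _; have [] := goodV n.
  apply: filter_from_filter => [|m n _ _]; first by exists 0%N.
  exists (maxn m n) => // x [Dx Vx].
  by split; split=> //; apply: subV Vx; rewrite ?leq_maxl ?leq_maxr.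
have [|x [_ clx]] := Xc BF; first by exists 0%N.
have inV n : closure (D `&` V n) x.
  by move: clx; rewrite clusterE; apply; exists n.
have Dx : D x by apply: clD; apply: closureS (inV 0%N) => y [].
have Vx n : (V n `&` ~` C n) x.
  by apply: clV; apply: closureS (inV n.+1) => y [].
have [|n _ Cx] := DUC x; first by split=> //; have [] := Vx 0%N.
by have [_] := Vx n.
Qed.

End Baire.

(** * Orbit representations, and topological freeness from stability under the projection *)

Section FreeFromIdeals.
Context (R : realType) (G : groupType) (X : topologicalType).
Context (sigma : G -> X -> X).
Hypothesis Xc : compact [set: X].
Hypothesis Xh : hausdorff_space X.
Hypothesis sa : homeo_action sigma.
Implicit Types (f g : G -> X -> Cplx R) (h : X -> Cplx R) (A B : {fset G}).

Lemma closed_fixed s : closed [set x | sigma s x = x].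
Proof.
rewrite -openC openE => x /= sx.
have xsx : x != sigma s x by apply/eqP => /esym.
move: (Xh); rewrite open_hausdorff => /(_ _ _ xsx)[[U V] /= [xU sxV] [oU oV /eqP UV]].
move/set_mem in xU; move/set_mem in sxV.
have oW : open (U `&` sigma s @^-1` V).
  apply: openI => //; apply: open_comp oV => y _.
  exact: (homeo_action_continuous sa).
apply: (filterS _ (open_nbhs_nbhs (conj oW (conj xU sxV)))) => y [Uy Vy] sy.
suff : set0 y by []; rewrite -UV; split=> //.
by move: Vy; rewrite /preimage /= sy.
Qed.

(* For [f] supported in [A], the [(z, w)] matrix entry of the operator
   [xi |-> fun z => \sum_t f t z * xi (t^-1 z)] on functions on the orbit of [z]. *)
Definition orbit_sum f A (z w : X) : Cplx R :=
  \sum_(t <- A) (if sigma t^-1%g z == w then f t z else 0).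

(** Matrix entries do not depend on the finite set chosen to contain the support, so elements with
    different supports can be compared. *)
Lemma orbit_sum_widen f A B z w : (A `<=` B)%fset ->
  (forall t, t \notin A -> f t = 0) -> orbit_sum f A z w = orbit_sum f B z w.
Proof.
move=> AB f0; apply: big_fset_incl => // t _ /f0->.
by case: ifP.
Qed.

Lemma orbit_sumD f g A z w :
  orbit_sum (f + g) A z w = orbit_sum f A z w + orbit_sum g A z w.
Proof.
rewrite -big_split; apply: eq_bigr => t _ /=.
by case: ifP; rewrite ?addr0.
Qed.

Lemma orbit_sumZ (a : R[i]) f A z w :
  orbit_sum (a *: f) A z w = a * orbit_sum f A z w.
Proof.
rewrite mulr_sumr; apply: eq_bigr => t _ /=.
by case: ifP; rewrite ?mulr0.
Qed.

Lemma cmod_orbit_sum f A z w : ell1 f -> cmod (orbit_sum f A z w) <= n1 f.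
Proof.
move=> lf; apply: le_trans (cmod_sum _ _) _; apply: le_trans (sum_le_n1 A lf).
apply: ler_sum => t _; case: ifP => _; last by rewrite cmod0 supnorm_ge0.
by apply: le_supnorm => //; exact: ell1_continuous.
Qed.

(** The finitely supported elements acting as zero on every orbit in [D]. Finite support keeps
    matrix entries finite sums; the ideal used later is the closure. *)
Definition orbit_kernel (D : set X) : set (G -> X -> Cplx R) :=
  [set f | (forall t, continuous (f t)) /\ exists A,
    (forall t, t \notin A -> f t = 0) /\
    forall z w, D z -> orbit_sum f A z w = 0].

Lemma orbit_kernel_ell1 D : orbit_kernel D `<=` ell1.
Proof.
move=> f [cf [A [f0 _]]].
apply: (@n1_le _ _ _ _ (\sum_(t <- A) supnorm (f t)) cf _).1 => B.
have AAB := fsubsetUl A B.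
have <- : \sum_(t <- (A `|` B)%fset) supnorm (f t) = \sum_(t <- A) supnorm (f t).
  by apply/esym/big_fset_incl => // t _ /f0->; exact: supnorm0.
rewrite (fsum_setD _ (fsubsetUr A B)) lerDl sumr_ge0// => t _.
exact: supnorm_ge0.
Qed.

Lemma closed_ideal_orbit_kernel D : invariant_set sigma D ->
  closed_ideal sigma (ell1_closure (orbit_kernel D)).
Proof.
move=> invD; apply: (closed_ideal_ell1_closure Xc sa).
- exact: orbit_kernel_ell1.
- split=> [t x|]; first exact: cst_continuous.
  by exists fset0; split=> // z w _; exact: big_seq_fset0.
- move=> f g [cf [A [f0 fA]]] [cg [B [g0 gB]]]; split=> [t x|].
    by apply: (@continuousD _ _ _ (f t) (g t)); [exact: cf|exact: cg].
  exists (A `|` B)%fset; split=> [t|z w Dz].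
    rewrite in_fsetU negb_or => /andP[/f0 ft /g0 gt].
    by have -> : (f + g) t = f t + g t by []; rewrite ft gt addr0.
  rewrite orbit_sumD -(orbit_sum_widen _ _ (fsubsetUl A B) f0).
  by rewrite -(orbit_sum_widen _ _ (fsubsetUr A B) g0) fA// gB// addr0.
- move=> a f [cf [A [f0 fA]]]; split=> [t|].
    by apply: (@continuous_mul _ _ (cst a)); [exact: cst_continuous|exact: cf].
  exists A; split=> [t /f0 ft|z w Dz]; last by rewrite orbit_sumZ fA// mulr0.
  by have -> : (a *: f) t = a *: f t by []; rewrite ft scaler0.
- move=> h t f ch [cf [A [f0 fA]]].
  have E s : ell1_mul sigma (mono h t) f s =
      fun x => h x * f (t^-1 * s)%g (sigma t^-1%g x).
    by apply/funext => x; rewrite mul_monoL.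
  split=> [s|].
    rewrite E; apply: (@continuous_mul _ _ h (f (t^-1 * s)%g \o sigma t^-1%g) ch).
    exact: (continuous_translate sa (cf (t^-1 * s)%g)).
  exists [fset (t * u)%g | u in A]%fset; split=> [s sA|z w Dz].
    rewrite E f0; last first.
      by apply: contraNN sA => ?; apply/imfsetP; exists (t^-1 * s)%g => //=; rewrite mulVKg.
    by apply/funext => x; exact: mulr0.
  rewrite /orbit_sum big_imfset /=; last by move=> ? ? _ _; exact: mulgI.
  (* The entry of the product at [(z, w)] is [h z] times that of [f] at [(t^-1 z, w)]; invariance
     keeps [t^-1 z] in [D]. *)
  transitivity (h z * orbit_sum f A (sigma t^-1%g z) w); last first.
    by rewrite fA ?mulr0//; exact: invD.
  rewrite mulr_sumr; apply: eq_bigr => u _.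
  rewrite E invgM (homeo_actionM sa) mulKg.
  by case: ifP; rewrite ?mulr0.
- move=> h t f ch [cf [A [f0 fA]]].
  have E s : ell1_mul sigma f (mono h t) s =
      fun x => f (s * t^-1)%g x * h (sigma (t * s^-1)%g x).
    by apply/funext => x; rewrite mul_monoR.
  split=> [s|].
    rewrite E; apply: (@continuous_mul _ _ (f (s * t^-1)%g) (h \o sigma (t * s^-1)%g) (cf _)).
    exact: (continuous_translate sa ch).
  exists [fset (u * t)%g | u in A]%fset; split=> [s sA|z w Dz].
    rewrite E f0; last first.
      by apply: contraNN sA => ?; apply/imfsetP; exists (s * t^-1)%g => //=; rewrite mulgVK.
    by apply/funext => x; exact: mul0r.
  rewrite /orbit_sum big_imfset /=; last by move=> ? ? _ _; exact: mulIg.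
  (* On this side the column moves from [w] to [t w], while the row [z] stays in [D]. *)
  transitivity (orbit_sum f A z (sigma t w) * h (sigma t w)); last first.
    by rewrite fA ?mul0r.
  rewrite mulr_suml; apply: eq_bigr => u _.
  rewrite E mulgK invgM mulVKg (homeo_actionM sa).
  rewrite -[X in if X then _ else _](can_eq (sigmaK sa t)) (sigmaVK sa).
  by case: eqP => [->|_]; rewrite ?mul0r.
Qed.

(** Where [h z <> 0], the point [z] is fixed by [s^-1], so both monomials have the same entries in
    row [z] and cancel; at other points of [D] both vanish. *)
Lemma orbit_kernel_difference D h s : s != 1%g -> continuous h ->
  (forall z, D z -> h z <> 0 -> sigma s z = z) ->
  orbit_kernel D (mono h 1%g - mono h s).
Proof.
move=> s1 ch hs; split=> [t x|].
  apply: (@continuousB _ _ _ (mono h 1%g t) (mono h s t)).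
    by rewrite /mono; case: ifP => _; [exact: ch|exact: cst_continuous].
  by rewrite /mono; case: ifP => _; [exact: ch|exact: cst_continuous].
have E t : (mono h 1%g - mono h s) t = mono h 1%g t - mono h s t by [].
have s1' : 1%g != s by rewrite eq_sym.
exists [fset 1%g; s]%fset; split=> [t|z w Dz].
  rewrite !inE negb_or => /andP[t1 ts].
  by rewrite E !mono_neq// subr0.
rewrite /orbit_sum big_fsetU1 /=; last by rewrite inE eq_sym.
rewrite big_seq_fset1 !E !monoE (mono_neq _ s1) (mono_neq _ s1') subr0 sub0r.
rewrite invg1 (homeo_action1 sa).
have [h0|/(hs _ Dz) sz] := pselect (h z = 0).
  by have -> : (- h) z = - h z by []; rewrite h0 oppr0 !if_same addr0.
have -> : sigma s^-1%g z = z by rewrite -{1}sz (sigmaK sa).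
by case: ifP => _; [exact: (subrr (h z))|exact: addr0].
Qed.

(** The entry at [(y, y)] is 1 for [h] and 0 on [orbit_kernel D], and entries are bounded by the
    norm; the distance is thus at least 1. *)
Lemma mono1_notin_orbit_closure D h y : D y -> continuous h -> h y = 1 ->
  ~ ell1_closure (orbit_kernel D) (mono h 1%g).
Proof.
move=> Dy ch hy [lh /(_ 2^-1)]; rewrite invr_gt0 ltr0n => /(_ isT)[g Sg hg].
have lg := orbit_kernel_ell1 Sg; case: Sg => cg [A [g0 gA]].
pose B := (1%g |` A)%fset.
have gB : orbit_sum g B y y = 0.
  by rewrite -(orbit_sum_widen _ _ (fsubsetUr [fset 1%g]%fset A) g0) gA.
have hB : orbit_sum (mono h 1%g) B y y = 1.
  rewrite -(@orbit_sum_widen _ [fset 1%g]%fset) ?fsubsetUl//.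
    by rewrite /orbit_sum big_seq_fset1 invg1 (homeo_action1 sa) eqxx monoE.
  by move=> t; rewrite inE => /mono_neq->.
have := cmod_orbit_sum B y y (ell1B Xc lh lg).1.
rewrite -scaleN1r orbit_sumD orbit_sumZ gB hB mulr0 addr0 cmod1 scaleN1r.
by move=> /le_lt_trans/(_ hg); rewrite ltNge invf_le1 ?ler1n.
Qed.

Lemma expectation_residually_free : countable [set: G] ->
  (forall I : set (G -> X -> Cplx R), closed_ideal sigma I ->
     forall f, I f -> I (mono (f 1%g) 1%g)) ->
  residually_topologically_free sigma.
Proof.
move=> Gc EI D invD clD O O0 oO; apply: contrapT => nfree.
have [U oU UO] : exists2 U, open U & set_val @^-1` U = O by exact: oO.
have DU0 : D `&` U !=set0.
  case: O0 => y; rewrite -UO => Uy; exists (set_val y); split=> //.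
  exact: set_valP.
have fixed x : (D `&` U) x -> exists2 s, s != 1%g & sigma s x = x.
  move=> [Dx Ux]; apply: contrapT => nofix.
  pose y : D := exist _ x (mem_set Dx).
  apply: nfree; exists y; split; first by rewrite -UO.
  move=> s s1 /(congr1 set_val) /= sx; apply: nofix.
  by exists s.
have /countable_injP[code codeI] := Gc.
(* The fixed point set of the element with code [n], empty when that element is the identity or does
   not exist. *)
pose C n := [set x | exists s, [/\ s != 1%g, code s = n & sigma s x = x]].
have clC n : closed (C n).
  have [[s [s1 sn]]|none] := pselect (exists s, s != 1%g /\ code s = n).
    rewrite (_ : C n = [set x | sigma s x = x]); first exact: closed_fixed.
    apply/seteqP; split=> x /= => [[t [_ tn tx]]|sx]; last by exists s.
    by have -> : s = t by apply: codeI; [exact: mem_set|exact: mem_set|rewrite sn tn].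
  rewrite (_ : C n = set0); first exact: closed0.
  by apply/seteqP; split=> // x [s [s1 sn _]]; apply: none; exists s.
have DUC : D `&` U `<=` \bigcup_n C n.
  by move=> x /fixed[s s1 sx]; exists (code s) => //; exists s.
have [n [V [oV [y [Dy Vy]] DVC]]] := compact_hausdorff_Baire Xc Xh clD oU DU0 clC DUC.
have [s [s1 sn _]] := DVC y (conj Dy Vy).
have fixV z : (D `&` V) z -> sigma s z = z.
  move=> /DVC[t [_ tn tz]].
  by have -> : s = t by apply: codeI; [exact: mem_set|exact: mem_set|rewrite sn tn].
have [|||q [cq _ q0 q1]] := urysohn R Xc Xh (_ : closed (~` V)) (_ : closed [set y]).
- exact: open_closedC.
- exact/accessible_closed_set1/hausdorff_accessible.
- by apply/seteqP; split=> z //= [nV zy]; apply: nV; rewrite zy.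
have ch : continuous (ofR q) by exact: continuous_ofR.
have hy : ofR q y = 1 by rewrite /ofR q1.
apply: (mono1_notin_orbit_closure Dy ch hy).
(* This difference lies in the ideal, and its coefficient at the identity is the bump function,
   which does not. *)
have := EI _ (closed_ideal_orbit_kernel invD) (mono (ofR q) 1%g - mono (ofR q) s).
set f0 := _ - _ => /(_ _)If0.
have f0E : f0 1%g = ofR q.
  have subE f g t : (f - g) t = f t - g t by [].
  by rewrite /f0 subE monoE mono_neq ?subr0// eq_sym.
rewrite -f0E; apply: If0.
apply: (sub_ell1_closure _); first exact: orbit_kernel_ell1.
apply: orbit_kernel_difference => // z Dz hz; apply: fixV; split=> //.
by apply: contrapT => /q0 qz; apply: hz; rewrite /ofR qz.
Qed.

End FreeFromIdeals.

(** * The cycle of implications from (1) through (2) and (3) back to (1) *)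

Theorem theorem3p19 (R : realType) (G : groupType) (X : topologicalType)
  (sigma : G -> X -> X)
  (G_countable : countable [set: G]) (G_infinite : infinite_set [set: G])
  (X_compact : compact [set: X]) (X_hausdorff : hausdorff_space X)
  (sigma_action : homeo_action sigma) :
  [<-> forall I J : set (G -> X -> Cplx R),
         closed_ideal sigma I -> closed_ideal sigma J ->
         I `&` CX = J `&` CX -> I = J;
       forall I : set (G -> X -> Cplx R), closed_ideal sigma I ->
         [set CX_incl (cond_proj f) | f in I] `<=` I;
       residually_topologically_free sigma].
Proof.
tfae.
- move=> ideals_eq I cI _ [f If <-].
  have invD := invariant_hull cI.
  (* Both ideals meet [CX] in the same set, so (1) identifies them; every coefficient of an element
     of the left one vanishes on the hull. *)
  have IE : vanishing (hull I) = I.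
    apply: ideals_eq (vanishing_hull_CX X_compact sigma_action cI) => //.
    exact: closed_ideal_vanishing.
  apply: (hull_kernel X_compact sigma_action cI) => [|x Dx].
    by apply: ell1_continuous; exact: (closed_ideal_sub cI).
  by move: If; rewrite -IE => -[_ f0]; exact: f0.
- move=> EI; apply: (@expectation_residually_free R) => // I cI f If.
  by apply: EI => //; exists f.
- move=> rtf I J cI cJ IJ.
  (* Each ideal is recovered from its hull, which depends only on the intersection with [CX]. *)
  rewrite (residually_free_vanishing X_compact X_hausdorff sigma_action rtf cI).
  rewrite (residually_free_vanishing X_compact X_hausdorff sigma_action rtf cJ).
  by rewrite (hull_eq IJ).
Qed.
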